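(* Let $\rho=\rho(n)\in(0,1]$ and $\delta=\delta(n)=1-\rho(n)$. (i) If $\rho(n)\cdot n/\log n\to\infty$ as $n\to\infty$, then $L_{1,\mathrm{worst}}(\delta(n),n)\ge (2/3-o(1))\,n$, where $o(1)$ denotes a quantity tending to $0$ as $n\to\infty$. (ii) There is an absolute constant $c>0$ such that if $\rho(n)\cdot n^{1/3}\to\infty$ as $n\to\infty$, then for all sufficiently large $n$, $L_{1,\mathrm{worst}}(\delta(n),n)\ge (2/3+c\,\rho(n))\,n$.
   Context: For $x\in\{0,1\}^n$ and $0<\delta<1$, the deletion channel $\mathrm{Del}_\delta(x)$ is the distribution over $\{0,1\}^{\le n}$ obtained by independently deleting each bit of $x$ with probability $\delta$ and concatenating the surviving bits; a draw from it is a trace of $x$, and $\rho=1-\delta$ is the retention rate. $|\mathsf{LCS}(u,v)|$ denotes the length of a longest common subsequence of strings $u,v$. A one-trace algorithm $A$ receives $n$, $\delta$ and one trace $y$ and outputs an $n$-bit string $A(y,n)$. Define $L_{1,\mathrm{worst}}(\delta,n):=\max_A\min_{x\in\{0,1\}^n}\mathbb{E}_{y\sim\mathrm{Del}_\delta(x)}[|\mathsf{LCS}(A(y,n),x)|]$, the maximum over all such algorithms. *)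

(* Defs.v *)
From HB Require Import structures.
From mathcomp Require Import all_boot all_order all_algebra.
From mathcomp Require Import all_classical all_reals all_analysis.

Set Implicit Arguments.
Unset Strict Implicit.
Unset Printing Implicit Defensive.

Import Order.TTheory GRing.Theory Num.Theory.
Import numFieldNormedType.Exports.

Local Open Scope ring_scope.

Definition lcs (u v : seq bool) : nat :=
  (\max_(w : (size u).-bseq bool | subseq w u && subseq w v) size w)%N.

Section DeletionChannel.
Variables (R : realType) (delta : R) (n : nat).
Implicit Types (x : n.-tuple bool) (y : n.-bseq bool).

(* [true] entries of the mask [m] are the retained positions, as in [mask]. *)
Definition mask_prob (m : n.-tuple bool) : R :=
  \prod_(i < n) (if tnth m i then 1 - delta else delta).

Definition Del x y : R :=
  \sum_(m : n.-tuple bool | mask m x == y :> seq bool) mask_prob m.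

Definition expect_Del x (f : n.-bseq bool -> R) : R :=
  \sum_(y : n.-bseq bool) Del x y * f y.

(* A deterministic one-trace algorithm for the given [n] and [delta], on which
   it may depend; there are finitely many of them. *)
Definition one_trace_alg := {ffun n.-bseq bool -> n.-tuple bool}.

Definition expected_lcs (A : one_trace_alg) x : R :=
  expect_Del x (fun y => (lcs (A y) x)%:R).

(* The starting points [x0] and [A0] below only witness nonemptiness of the
   (finite) ranges of the min and of the max. *)
Definition worst_expected_lcs (A : one_trace_alg) : R :=
  let x0 : n.-tuple bool := [tuple of nseq n false] in
  expected_lcs A [arg min_(x < x0) expected_lcs A x]%O.

Definition L1worst : R :=
  let A0 : one_trace_alg := [ffun=> [tuple of nseq n false]] in
  worst_expected_lcs [arg max_(A > A0) worst_expected_lcs A]%O.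

End DeletionChannel.

(* Main.v *)
(* Write alt(c, k) for the alternating string of length k starting with c.  A
   string v embeds in alt(c, 2|v| - d) when v has d positions at which the letter
   changes.  Cut x into u v r with |v| = l.  The string
   b1^(|u|/2) alt(true, .) b3^(|r|/2) of total length n contains v entirely, and
   half of u and of r as soon as b1 and b3 are majority letters of u and r, which
   can be read off one trace up to an error O(sqrt(n / rho)).  With l = n/3 this
   gives (i).  If v shows many changes, l can be taken larger.  So for (ii), when
   the trace has at least a small multiple of rho n changes, use the best of three
   windows v that cover x.  Otherwise x is essentially constant on most blocks of
   length C / rho, and repeating each letter of the trace about 1 / rho times
   recovers well over two thirds of x.  By the Efron-Stein inequality the trace
   misleads this choice with probability O(1 / (rho n)), a loss of O(1 / rho),
   which is negligible against rho n. *)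
Require Import Defs.
From mathcomp Require Import all_boot all_order all_algebra.
From mathcomp Require Import all_classical all_reals all_analysis.
From mathcomp Require Import zify ring lra.

Set Implicit Arguments.
Unset Strict Implicit.
Unset Printing Implicit Defensive.

Import Order.TTheory GRing.Theory Num.Theory.
Import numFieldNormedType.Exports.

(** * Longest common subsequences and letter changes *)

Local Open Scope nat_scope.

Lemma leq_lcs (w u v : seq bool) : subseq w u -> subseq w v -> size w <= lcs u v.
Proof.
move=> wu wv.
have sw : size w <= size u by exact: size_subseq.
by apply: (@leq_bigmax_cond _ _ (fun w : (size u).-bseq bool => size w) (Bseq sw));
  rewrite wu wv.
Qed.

Lemma lcs_attained (u v : seq bool) :
  exists w : seq bool, [/\ subseq w u, subseq w v & size w = lcs u v].
Proof.
have [w /andP[wu wv] e] : {w : (size u).-bseq bool |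
    subseq w u && subseq w v & lcs u v = size w}.
  apply: (@eq_bigmax_cond _ [pred w : (size u).-bseq bool | subseq w u && subseq w v]
    (fun w : (size u).-bseq bool => size w)).
  by apply/card_gt0P; exists (@Bseq (size u) _ [::] isT); rewrite inE /= !sub0seq.
by exists w.
Qed.

Lemma lcs_sub (u u' v v' : seq bool) :
  subseq u u' -> subseq v v' -> lcs u v <= lcs u' v'.
Proof.
move=> uu' vv'; have [w [wu wv <-]] := lcs_attained u v.
by apply: leq_lcs; [exact: subseq_trans uu'|exact: subseq_trans vv'].
Qed.

Lemma lcs_cat (u1 u2 v1 v2 : seq bool) :
  lcs u1 v1 + lcs u2 v2 <= lcs (u1 ++ u2) (v1 ++ v2).
Proof.
have [w1 [a1 b1 <-]] := lcs_attained u1 v1.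
have [w2 [a2 b2 <-]] := lcs_attained u2 v2.
by rewrite -size_cat; apply: leq_lcs; apply: cat_subseq.
Qed.

(** At most [size t] letters of an optimal common subsequence come from [t], and dropping them
    leaves a common subsequence of [s1 ++ s2] and [v]. *)
Lemma lcs_insert (s1 t s2 v : seq bool) :
  lcs (s1 ++ t ++ s2) v <= lcs (s1 ++ s2) v + size t.
Proof.
have [w [/subseqP[m sm ->] wv <-]] := lcs_attained (s1 ++ t ++ s2) v.
have {}sm : size m = size s1 + (size t + size s2) by rewrite sm !size_cat.
move: wv.
rewrite -(cat_take_drop (size s1) m) -(cat_take_drop (size t) (drop (size s1) m)).
set m1 := take _ m; set m2 := take (size t) _; set m3 := drop _ (drop _ _).
have e1 : size m1 = size s1 by rewrite size_takel // sm; lia.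
have e2 : size m2 = size t by rewrite size_takel // size_drop sm; lia.
have e3 : size m3 = size s2 by rewrite !size_drop sm; lia.
rewrite !mask_cat // => wv.
have : size (mask m1 s1 ++ mask m3 s2) <= lcs (s1 ++ s2) v.
  apply: leq_lcs; first by apply: cat_subseq; exact: mask_subseq.
  apply: subseq_trans wv; apply: cat_subseq => //; exact: suffix_subseq.
have : size (mask m2 t) <= size t by apply/size_subseq/mask_subseq.
rewrite !size_cat /=; lia.
Qed.

Lemma subseq_nseq (b : bool) k (s : seq bool) :
  k <= count_mem b s -> subseq (nseq k b) s.
Proof.
elim: s k => [|c s IH] [|k] //=.
by case: (eqVneq c b) => _ /=; [rewrite add1n ltnS => /IH|move=> /IH].
Qed.

Lemma lcs_nseq (b : bool) k (s : seq bool) :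
  minn k (count_mem b s) <= lcs (nseq k b) s.
Proof.
have -> : minn k (count_mem b s) = size (nseq (minn k (count_mem b s)) b).
  by rewrite size_nseq.
apply: leq_lcs; apply: subseq_nseq; last exact: geq_minr.
by rewrite count_nseq /= eqxx mul1n geq_minl.
Qed.

(** * Letter changes of a binary string *)

Fixpoint changes_from (b : bool) (s : seq bool) : nat :=
  if s is c :: s' then (b != c) + changes_from c s' else 0.

(** Starting from the head makes the first comparison free, so this counts adjacent unequal pairs:
    one less than the number of runs of a nonempty string. *)
Definition changes (s : seq bool) : nat := changes_from (head false s) s.

Lemma changes_from_ge b s : changes s <= changes_from b s.
Proof. by case: s => //= c s; rewrite /changes /= eqxx; lia. Qed.

Lemma changes_from_le b c s : changes_from b s <= changes_from c s + 1.
Proof. by case: s => //= d s; case: b; case: c; case: d; lia. Qed.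

Lemma changes_from_le1 b s : changes_from b s <= changes s + 1.
Proof. exact: changes_from_le. Qed.

Lemma changes_from_cat b s t :
  changes_from b (s ++ t) = changes_from b s + changes_from (last b s) t.
Proof. by elim: s b => //= c s IH b; rewrite IH addnA. Qed.

Lemma changes_from_size b s : changes_from b s <= size s.
Proof. by elim: s b => //= c s IH b; have := IH c; case: (b != c); lia. Qed.

Lemma changes_size s : changes s <= size s.
Proof. exact: changes_from_size. Qed.

Lemma changes_cat_ge s t : changes s + changes t <= changes (s ++ t).
Proof.
case: s => [|b s]; first by rewrite add0n.
by rewrite /changes /= changes_from_cat eqxx -addnA leq_add2l leq_add2l changes_from_ge.
Qed.

Lemma changes_cat_le s t : changes (s ++ t) <= changes s + changes t + 1.
Proof.
case: s => [|b s]; first by rewrite /= ; lia.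
rewrite /changes /= changes_from_cat eqxx; have := changes_from_le1 (last b s) t.
by rewrite /changes; lia.
Qed.

Lemma changes_cat_size s t : changes (s ++ t) <= changes s + size t.
Proof.
case: s => [|b s]; first by rewrite /= ; exact: changes_size.
rewrite /changes /= changes_from_cat eqxx.
by have := changes_from_size (last b s) t; lia.
Qed.

(** Skipping a letter [c] of [t] replaces the start letter [b] by [c]. This costs at most one
    change, and only if [b != c], in which case the skipped letter itself counts as a change of
    [t]. *)
Lemma changes_from_subseq b s t : subseq s t -> changes_from b s <= changes_from b t.
Proof.
elim: t b s => [|c t IH] b [|d s] //=.
case: eqVneq => [->|dc] st; first by rewrite leq_add2l; exact: IH.
have /= := IH c _ st; have := changes_from_le b c (d :: s) => /=.
by case: b; case: c dc {IH st}; case: d => //=; lia.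
Qed.

Lemma changes_subseq s t : subseq s t -> changes s <= changes t.
Proof.
move=> st; exact: leq_trans (changes_from_ge (head false t) s) (changes_from_subseq _ st).
Qed.

Lemma changes_insert s1 c s2 : changes (s1 ++ c :: s2) <= changes (s1 ++ s2) + 2.
Proof.
have := changes_cat_le s1 (c :: s2); have := changes_cat_ge s1 s2.
have : changes (c :: s2) <= changes s2 + 1.
  by rewrite /changes /= eqxx; exact: changes_from_le1.
lia.
Qed.

Lemma changes_ge1 (b : bool) s : b \in s -> ~~ b \in s -> 0 < changes s.
Proof.
move=> bs nbs.
have {bs nbs} : exists t, subseq t s /\ changes t = 1.
  elim: s bs nbs => // c s IH; rewrite !inE.
  case: (boolP ((b \in s) && (~~ b \in s))) => [/andP[h1 h2] _ _|].
    have [t [ts e]] := IH h1 h2; exists t; split => //.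
    exact: subseq_trans ts (subseq_cons _ _).
  rewrite negb_and => hn /orP h1 /orP h2.
  have : ~~ c \in s.
    by move: hn h1 h2; case: b {IH}; case: c => /=; case: (true \in s);
      case: (false \in s) => //= ? [] // ? [].
  rewrite -sub1seq => cs; exists [:: c; ~~ c]; split; first by rewrite /= eqxx.
  by case: (c).
by case=> t [ts e]; rewrite -e; exact: changes_subseq.
Qed.

(** * Embedding into alternating strings *)

Fixpoint alternating_string (c : bool) (k : nat) : seq bool :=
  if k is k'.+1 then c :: alternating_string (~~ c) k' else [::].

Lemma size_alternating_string c k : size (alternating_string c k) = k.
Proof. by elim: k c => //= k IH c; rewrite IH. Qed.

(* Greedy embedding of [v]: a letter costs one letter of the alternating string
   if it differs from its predecessor in [v], and two otherwise. *)
Lemma lcs_alternating c k v :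
  size v <= lcs (alternating_string c k) v + (2 * size v - changes_from (~~ c) v - k).
Proof.
elim: v c k => [|d v IH] c k //=.
have sz := changes_from_size d v.
have cons_lcs e s t : lcs s t + 1 <= lcs (e :: s) (e :: t).
  rewrite addnC -[1]/(size [:: e]) -[e :: s]cat1s -[e :: t]cat1s.
  apply: leq_trans (lcs_cat _ _ _ _); rewrite leq_add2r; exact: leq_lcs.
case: (eqVneq d c) => [dc|dc].
  have -> : (~~ c != d) = true by rewrite dc; case: (c).
  case: k => [|k] /=; first by lia.
  have := cons_lcs c (alternating_string (~~ c) k) v; have := IH (~~ c) k.
  by rewrite negbK dc in sz *; lia.
(* Here [v] starts with the second letter of the alternating string; the first one is given up, so
   that two letters are spent on one. *)
have dE : d = ~~ c by case: c d dc {IH sz} => -[].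
have -> : (~~ c != d) = false by rewrite dE eqxx.
case: k => [|[|k]] /=; [lia|lia|].
have h1 := cons_lcs (~~ c) (alternating_string c k) v; have h2 := IH c k.
rewrite dE in sz *.
have h3 : lcs (~~ c :: alternating_string c k) (~~ c :: v) <=
    lcs [:: c, ~~ c & alternating_string c k] (~~ c :: v).
  by apply: lcs_sub => //; exact: subseq_cons.
by rewrite negbK; lia.
Qed.

Local Open Scope ring_scope.

(** * Expectation over random masks *)

(** Isolates the effect of a single mask bit: flipping it inserts or removes one letter [c] of the
    trace. All bounded-difference estimates rest on this. *)
Lemma mask_split (s1 s2 x : seq bool) :
  (size s1 + size s2).+1 = size x ->
  exists x1 c x2, size x1 = size s1 /\ size x2 = size s2 /\ x = x1 ++ c :: x2 /\
   forall b, mask (s1 ++ b :: s2) x = mask s1 x1 ++ nseq b c ++ mask s2 x2.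
Proof.
move=> e; exists (take (size s1) x), (nth false x (size s1)), (drop (size s1).+1 x).
have h1 : size (take (size s1) x) = size s1 by rewrite size_takel // -e; lia.
have h2 : size (drop (size s1).+1 x) = size s2 by rewrite size_drop -e; lia.
have h3 : x = take (size s1) x ++ nth false x (size s1) :: drop (size s1).+1 x.
  by rewrite -drop_nth ?cat_take_drop // -e; lia.
do 3!split => //.
by move=> d; rewrite {1}h3 mask_cat // mask_cons.
Qed.

Section MaskExpectation.
Variables (R : realType) (rho : R).
Hypotheses (rho0 : 0 <= rho) (rho1 : rho <= 1).
Implicit Types F G : seq bool -> R.

(** The recursion on the first bit turns identities about expectations into inductions on the
    length; [sum_mask_prob] links it to the sum over tuples. *)
Fixpoint mask_expect (n : nat) F : R :=
  if n is n'.+1 then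
    rho * mask_expect n' (fun m => F (true :: m)) +
    (1 - rho) * mask_expect n' (fun m => F (false :: m))
  else F [::].
Local Notation EM := mask_expect.

Lemma mask_expect_le n F G :
  (forall m, size m = n -> F m <= G m) -> EM n F <= EM n G.
Proof.
elim: n F G => [|n IH] F G h /=; first exact: h.
by apply: lerD; apply: ler_wpM2l; rewrite ?subr_ge0 //; apply: IH => m sm;
  apply: h; rewrite /= sm.
Qed.

Lemma eq_mask_expect n F G :
  (forall m, size m = n -> F m = G m) -> EM n F = EM n G.
Proof. by move=> h; apply/le_anti; rewrite !mask_expect_le // => m /h ->. Qed.

Lemma mask_expectD n F G : EM n (fun m => F m + G m) = EM n F + EM n G.
Proof. by elim: n F G => [|n IH] F G //=; rewrite !IH; ring. Qed.

Lemma mask_expectZ n a F : EM n (fun m => a * F m) = a * EM n F.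
Proof. by elim: n F => [|n IH] F //=; rewrite !IH; ring. Qed.

Lemma mask_expect_cst n (c : R) : EM n (fun=> c) = c.
Proof. by elim: n => //= n ->; ring. Qed.

Lemma mask_expectB n F G : EM n (fun m => F m - G m) = EM n F - EM n G.
Proof.
rewrite -[- EM n G]mulN1r -mask_expectZ -mask_expectD.
by apply: eq_mask_expect => m _; rewrite mulN1r.
Qed.

Lemma mask_expect_ge0 n F : (forall m, size m = n -> 0 <= F m) -> 0 <= EM n F.
Proof. by move=> h; rewrite -(mask_expect_cst n 0); exact: mask_expect_le. Qed.

Lemma mask_expect_cat p q F :
  EM (p + q) F = EM p (fun m1 => EM q (fun m2 => F (m1 ++ m2))).
Proof. by elim: p F => //= p IH F; rewrite !IH. Qed.

Lemma mask_expect_take k n F : (k <= n)%N -> EM n (fun m => F (take k m)) = EM k F.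
Proof.
move=> kn; rewrite -(subnKC kn) mask_expect_cat; apply: eq_mask_expect => m sm.
rewrite -[RHS](mask_expect_cst (n - k)); apply: eq_mask_expect => m2 _.
by rewrite -sm take_size_cat.
Qed.

Definition mask_lipschitz n (L : R) F := forall s1 s2,
  (size s1 + size s2).+1 = n -> `|F (s1 ++ true :: s2) - F (s1 ++ false :: s2)| <= L.

(* Efron-Stein inequality: conditioning on the first bit splits the variance
   into the mean conditional variance and the variance of a two-valued variable. *)
Lemma mask_variance n L F : 0 <= L -> mask_lipschitz n L F ->
  EM n (fun m => (F m - EM n F) ^+ 2) <= n%:R * rho * L ^+ 2.
Proof.
move=> L0; elim: n F => [|n IH] F h /=; first by rewrite subrr expr0n !mul0r.
set Ft := fun m => F (true :: m); set Ff := fun m => F (false :: m).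
have lip (b : bool) : mask_lipschitz n L (fun m => F (b :: m)).
  by move=> s1 s2 e; apply: (h (b :: s1) s2); rewrite /= addSn e.
have := IH _ (lip true); have := IH _ (lip false); rewrite -/Ft -/Ff.
set t := EM n Ft; set f := EM n Ff => Vf Vt.
(* The second moment about [c] is the variance plus the squared bias, since the cross term has mean
   zero. *)
have shift G (c : R) : EM n (fun m => (G m - c) ^+ 2) =
    EM n (fun m => (G m - EM n G) ^+ 2) + (EM n G - c) ^+ 2.
  set g := EM n G.
  have -> : EM n (fun m => (G m - c) ^+ 2) = EM n (fun m => (G m - g) ^+ 2 +
     (2 * (g - c) * (G m - g) + (g - c) ^+ 2)).
    by apply: eq_mask_expect => m _; ring.
  rewrite mask_expectD mask_expectD mask_expectZ mask_expectB !mask_expect_cst -/g.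
  by ring.
rewrite (shift Ft) (shift Ff) -/t -/f.
have : `|t - f| <= L.
  rewrite -mask_expectB ler_norml; apply/andP; split.
    rewrite -[X in X <= _](mask_expect_cst n); apply: mask_expect_le => m sm.
    by have := h [::] m; rewrite /= sm => /(_ erefl); rewrite ler_norml => /andP[].
  rewrite -[X in _ <= X](mask_expect_cst n); apply: mask_expect_le => m sm.
  by have := h [::] m; rewrite /= sm => /(_ erefl); rewrite ler_norml => /andP[].
move=> tf; have : (t - f) ^+ 2 <= L ^+ 2.
  by rewrite -real_normK ?num_real // lerXn2r ?nnegrE.
set Vft := EM n _ in Vt *; set Vff := EM n _ in Vf *.
move=> tf2.
have h1 : rho * Vft <= rho * (n%:R * rho * L ^+ 2) by apply: ler_wpM2l.
have h2 : (1 - rho) * Vff <= (1 - rho) * (n%:R * rho * L ^+ 2).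
  by apply: ler_wpM2l => //; rewrite subr_ge0.
have h3 : rho * (1 - rho) * (t - f) ^+ 2 <= rho * L ^+ 2.
  apply: (@le_trans _ _ (rho * (t - f) ^+ 2)); last exact: ler_wpM2l.
  apply: ler_wpM2r; first exact: sqr_ge0.
  by rewrite ler_piMr // lerBlDr lerDl.
rewrite -[n.+1]addn1 natrD.
(* The conditional means [t] and [f] form a two-valued variable of variance
   [rho * (1 - rho) * (t - f) ^+ 2]. *)
have -> : rho * (Vft + (t - (rho * t + (1 - rho) * f)) ^+ 2) +
  (1 - rho) * (Vff + (f - (rho * t + (1 - rho) * f)) ^+ 2) =
  rho * Vft + (1 - rho) * Vff + rho * (1 - rho) * (t - f) ^+ 2 by ring.
by lra.
Qed.

Lemma mask_count_mean (a : pred bool) (x : seq bool) :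
  EM (size x) (fun m => (count a (mask m x))%:R) = rho * (count a x)%:R.
Proof.
elim: x => [|b x IH] /=; first by rewrite mulr0.
rewrite natrD [X in (1 - rho) * X](_ : _ = rho * (count a x)%:R); last exact: IH.
have -> : EM (size x) (fun m => (a b + count a (mask m x))%:R) =
   (a b)%:R + rho * (count a x)%:R.
  rewrite -IH -[X in X + _](mask_expect_cst (size x)) -mask_expectD.
  by apply: eq_mask_expect => m _; rewrite natrD.
by ring.
Qed.

Lemma mask_count_deviation (a : pred bool) (x : seq bool) (N : R) :
  (size x)%:R <= N ->
  EM (size x) (fun m => `|(count a (mask m x))%:R - rho * (count a x)%:R|) <=
    Num.sqrt (rho * N).
Proof.
move=> xN; set D : seq bool -> R := fun m => _; set s : R := Num.sqrt _.
have N0 : 0 <= rho * N by rewrite mulr_ge0 // (le_trans _ xN).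
have V : EM (size x) (fun m => D m ^+ 2) <= s ^+ 2.
  rewrite sqr_sqrtr //; apply: le_trans (ler_wpM2l rho0 xN).
  have lip : mask_lipschitz (size x) 1 (fun m => (count a (mask m x))%:R).
    move=> s1 s2 e; have [x1 [c [x2 [_ [_ [_ hb]]]]]] := mask_split e.
    rewrite !hb /= !count_cat /= !natrD opprD addrACA subrr add0r addrK.
    by case: (a c); rewrite /= ?normr1 ?normr0.
  have := mask_variance ler01 lip; rewrite expr1n mulr1 [_ * rho]mulrC.
  rewrite mask_count_mean; apply: le_trans; apply: mask_expect_le => m _.
  by rewrite /D real_normK ?num_real.
have E : (EM (size x) D) ^+ 2 <= s ^+ 2.
  apply: le_trans V; rewrite -subr_ge0.
  (* The mean of [D] is at most the root of its second moment, because the difference of the squares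
     is the variance of [D]. *)
  rewrite (_ : _ - _ = EM (size x) (fun m => (D m - EM (size x) D) ^+ 2)).
    by apply: mask_expect_ge0 => m _; exact: sqr_ge0.
  set d := EM (size x) D; rewrite -[RHS](eq_mask_expect
    (F := fun m => D m ^+ 2 + (- (2 * d) * D m + d ^+ 2))); last by move=> m _; ring.
  by rewrite !mask_expectD mask_expectZ mask_expect_cst -/d; ring.
rewrite -(@ler_sqr R) ?nnegrE ?sqrtr_ge0 //; apply: mask_expect_ge0 => // m _.
exact: normr_ge0.
Qed.

Lemma mask_notin (b : bool) (x : seq bool) :
  EM (size x) (fun m => (b \notin mask m x)%:R) = (1 - rho) ^+ (count_mem b x).
Proof.
elim: x => [|c x IH] //=.
rewrite [X in (1 - rho) * X](_ : _ = (1 - rho) ^+ count_mem b x); last exact: IH.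
case: (eqVneq c b) => [->|cb].
  rewrite [X in rho * X](_ : _ = 0); first by rewrite add1n exprS mulr0 add0r.
  rewrite -[RHS](mask_expect_cst (size x)); apply: eq_mask_expect => m _.
  by rewrite in_cons eqxx.
rewrite [X in rho * X](_ : _ = (1 - rho) ^+ count_mem b x) ?add0n; first by ring.
rewrite -IH; apply: eq_mask_expect => m _.
by rewrite in_cons eq_sym (negbTE cb).
Qed.

Lemma mask_nil (x : seq bool) :
  EM (size x) (fun m => (mask m x == [::])%:R) = (1 - rho) ^+ (size x).
Proof.
elim: x => [|c x IH] //=.
rewrite [X in (1 - rho) * X](_ : _ = (1 - rho) ^+ size x); last exact: IH.
by rewrite mask_expect_cst mulr0 add0r exprS.
Qed.

End MaskExpectation.

(** * From the deletion channel to random masks *)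

Lemma sum_mask_prob (R : realType) (rho : R) n (F : seq bool -> R) :
  \sum_(m : n.-tuple bool) mask_prob (1 - rho) m * F m = mask_expect rho n F.
Proof.
elim: n F => [|n IH] F /=.
  rewrite (big_pred1 [tuple]) => [|m]; last by rewrite [m]tuple0; apply/esym/eqP.
  by rewrite /mask_prob big_ord0 mul1r.
pose h (p : bool * n.-tuple bool) : n.+1.-tuple bool := [tuple of p.1 :: p.2].
have hb : bijective h.
  exists (fun m => (thead m, [tuple of behead m])) => [[b m]|m].
    by congr pair; apply: val_inj.
  by rewrite /h /= [RHS]tuple_eta.
rewrite (reindex h) /=; last exact: onW_bij.
rewrite -(pair_big xpredT xpredT (fun b m => mask_prob (1 - rho) (h (b, m)) * F (h (b, m)))) /=.
have mp b m : mask_prob (1 - rho) (h (b, m)) =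
    (if b then rho else 1 - rho) * mask_prob (1 - rho) m.
  rewrite /mask_prob big_ord_recl tnth0; congr (_ * _); first by case: b => //; ring.
  by apply: eq_bigr => i _; rewrite tnthS.
rewrite big_bool /= -!IH !mulr_sumr; congr (_ + _); apply: eq_bigr => m _;
  by rewrite mp mulrA.
Qed.

(** It suffices to analyse one decision rule [D], since the maximum over algorithms is at least its
    value. After exchanging the sums over traces and masks, each mask contributes to exactly one
    trace. *)
Lemma L1worst_ge (R : realType) (rho : R) n (D : seq bool -> n.-tuple bool) (b : R) :
  (forall x : n.-tuple bool,
     b <= mask_expect rho n (fun m => (lcs (D (mask m x)) x)%:R)) ->
  b <= L1worst (1 - rho) n.
Proof.
move=> hD; pose A : one_trace_alg n := [ffun y : n.-bseq bool => D y].
have hA x : b <= expected_lcs (1 - rho) A x.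
  apply: le_trans (hD x) _; rewrite -sum_mask_prob /expected_lcs /expect_Del /Del.
  under [X in _ <= X]eq_bigr do rewrite mulr_suml.
  rewrite [X in _ <= X](exchange_big_dep xpredT) //=; apply: ler_sum => m _.
  have sm : (size (mask m x) <= n)%N.
    by rewrite (leq_trans (size_subseq (mask_subseq m x))) ?size_tuple.
  rewrite (big_pred1 (Bseq sm)); last by move=> y; rewrite /= eq_sym.
  by rewrite ffunE.
rewrite /L1worst; case: arg_maxP => // B _ hB.
apply: le_trans (hB A isT); exact: hA.
Qed.

(** * The window strategy *)

(* The middle part is meant to contain the window [p, p + l) of [x] entirely,
   the two outer parts half of what precedes and of what follows it. *)
Definition window_string n p l (b1 b3 : bool) : seq bool :=
  let h1 := (p %/ 2)%N in let h3 := ((n - p - l) %/ 2)%N in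
  nseq h1 b1 ++ alternating_string true (n - h1 - h3) ++ nseq h3 b3.

Lemma size_window_string n p l b1 b3 : (p + l <= n)%N ->
  size (window_string n p l b1 b3) = n.
Proof.
move=> pl; rewrite !size_cat !size_nseq size_alternating_string.
lia.
Qed.

(** The three parts contribute about [p / 2], [l] and [(n - p - l) / 2], where [n] is the length of
    [x]. The numbers [e1], [e2], [e3] are shortfalls in the hypotheses, and the 1 pays for two
    halves rounded down. *)
Lemma lcs_window_string (R : realType) (x : seq bool) p l b1 b3 (e1 e2 e3 : R) :
  (p + l <= size x)%N -> 0 <= e1 -> 0 <= e2 -> 0 <= e3 ->
  p%:R / 2 <= (count_mem b1 (take p x))%:R + e1 ->
  (3 * l%:R - (size x)%:R) / 2 <= (changes (take l (drop p x)))%:R + e2 ->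
  ((size x)%:R - p%:R - l%:R) / 2 <= (count_mem b3 (drop (p + l) x))%:R + e3 ->
  ((size x)%:R + l%:R) / 2 - 1 - e1 - e2 - e3 <=
    (lcs (window_string (size x) p l b1 b3) x)%:R.
Proof.
set n := size x => pl e1p e2p e3p H1 H2 H3.
set u := take p x in H1 *; set v := take l (drop p x) in H2 *.
set r := drop (p + l) x in H3 *.
have xE : x = u ++ v ++ r by rewrite /r addnC -drop_drop !cat_take_drop.
rewrite /window_string {1}xE.
set h1 := (p %/ 2)%N; set h3 := ((n - p - l) %/ 2)%N.
set L := (n - h1 - h3)%N.
have sv : size v = l by rewrite size_takel // size_drop; lia.
have B1 : (p <= 2 * h1 + 1)%N by rewrite /h1; lia.
have B3 : (n <= 2 * h3 + p + l + 1)%N by rewrite /h3; lia.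
(* The outer parts take at most [(n - l) / 2] letters, which leaves [(n + l) / 2] for the middle,
   where [2 * l - changes v] letters suffice. *)
have BL : (n + l <= 2 * L)%N by rewrite /L /h1 /h3; lia.
have G0 := lcs_cat (nseq h1 b1) (alternating_string true L ++ nseq h3 b3) u (v ++ r).
have G1 := lcs_cat (alternating_string true L) (nseq h3 b3) v r.
have G2 := lcs_nseq b1 h1 u; have G3 := lcs_nseq b3 h3 r.
have G4 := lcs_alternating true L v; rewrite sv in G4.
have G5 := changes_from_ge (~~ true) v.
set X := lcs _ _; rewrite -/X in G0; move: G0 G1.
set X1 := lcs _ u; set X2 := lcs _ (v ++ r); set Y2 := lcs _ v; set Y3 := lcs _ r.
move=> G0 G1.
have {G0 G1} GX : (X1 + Y2 + Y3 <= X)%N by lia.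
have Z1 : p%:R / 2 - 1/2 - e1 <= X1%:R.
  move: G2; rewrite -/X1 -(ler_nat R); move: B1; rewrite -(ler_nat R) natrD natrM.
  by rewrite /minn; case: ifP => _; lra.
have Z3 : (n%:R - p%:R - l%:R) / 2 - 1/2 - e3 <= Y3%:R.
  move: G3; rewrite -/Y3 -(ler_nat R); move: B3; rewrite -(ler_nat R) 3!natrD natrM.
  by rewrite /minn; case: ifP => _; lra.
have Z2 : l%:R - e2 <= Y2%:R.
  move: BL; rewrite -(ler_nat R) natrD natrM.
  have [h|h] := leqP (2 * l) (changes v + L)%N.
    have : (l <= Y2)%N by rewrite -/Y2 in G4; lia.
    by rewrite -(ler_nat R); lra.
  have : (changes v + L <= Y2 + l)%N by rewrite -/Y2 in G4; lia.
  by rewrite -(ler_nat R) !natrD; lra.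
move: GX; rewrite -(ler_nat R) !natrD; lra.
Qed.

(** Serves lengths, letter counts and numbers of changes alike: it absorbs the error of cutting a
    trace at an estimated position. *)
Lemma take_lipschitz (R : realType) (f : seq bool -> nat) (s : seq bool) a b :
  (forall s t, (f s <= f (s ++ t) <= f s + size t)%N) ->
  `|(f (take a s))%:R - (f (take b s))%:R : R| <= `|a%:R - b%:R|.
Proof.
move=> hf; wlog ab : a b / (a <= b)%N.
  by move=> h; case: (leqP a b) => [|/ltnW] /h //; rewrite distrC [leRHS]distrC.
have e : take b s = take a s ++ take (b - a) (drop a s).
  by rewrite -takeD subnKC.
have := hf (take a s) (take (b - a) (drop a s)); rewrite -e => /andP[h1 h2].
have h3 : (size (take (b - a) (drop a s)) <= b - a)%N by rewrite size_take_min geq_minl.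
have {h2 h3} h2 : (f (take b s) + a <= f (take a s) + b)%N by lia.
move: h1 h2 ab; rewrite -!(ler_nat R) !natrD => h1 h2 ab.
by rewrite !ler0_norm ?subr_le0 //; lra.
Qed.

(** * Reading prefixes and windows of the input off a trace *)

Section Deviations.
Variables (R : realType) (rho : R).
Hypotheses (rho0 : 0 < rho) (rho1 : rho <= 1).

(* A trace of [x] is expected to have received about [rho * k] letters from the
   first [k] letters of [x]. *)
Definition trace_index (k : nat) : nat := Num.truncn (rho * k%:R).

Lemma trace_index_dist k : `|(trace_index k)%:R - rho * k%:R| <= 1.
Proof.
have /truncn_itv/andP[h1 h2] : 0 <= rho * k%:R by rewrite mulr_ge0 // ltW.
rewrite /trace_index in h1 h2 *; rewrite -natr1 in h2.
by rewrite ler0_norm ?subr_le0 //; lra.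
Qed.

Variable x : seq bool.
Let n := size x.

Definition count_dev (a : pred bool) k (m : seq bool) : R :=
  `|(count a (mask (take k m) (take k x)))%:R - rho * (count a (take k x))%:R|.

(** One quantity controls the length and both letter counts, so later estimates need not know which
    letter is the majority. *)
Definition prefix_dev k m : R :=
  count_dev predT k m + (count_dev (pred1 true) k m + count_dev (pred1 false) k m).

Lemma count_dev_ge0 a k m : 0 <= count_dev a k m.
Proof. exact: normr_ge0. Qed.

Lemma prefix_dev_ge0 k m : 0 <= prefix_dev k m.
Proof. by rewrite /prefix_dev !addr_ge0 ?count_dev_ge0. Qed.

Lemma prefix_dev_expect k : (k <= n)%N ->
  mask_expect rho n (prefix_dev k) <= 3 * Num.sqrt (rho * n%:R).
Proof.
move=> kn; rewrite !mask_expectD.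
have h a : mask_expect rho n (count_dev a k) <= Num.sqrt (rho * n%:R).
  rewrite (mask_expect_take (ltW rho0) rho1 (fun m => `|(count a (mask m (take k x)))%:R -
    rho * (count a (take k x))%:R|) kn).
  rewrite -[X in mask_expect _ X](size_takel kn).
  apply: mask_count_deviation => //; first exact: ltW.
  by rewrite size_takel // ler_nat.
by have := h predT; have := h (pred1 true); have := h (pred1 false); lra.
Qed.

Lemma count_prefix_dev b k m :
  `|(count_mem b (mask (take k m) (take k x)))%:R - rho * (count_mem b (take k x))%:R|
    <= prefix_dev k m.
Proof.
rewrite /prefix_dev; have := count_dev_ge0 predT k m.
have := count_dev_ge0 (pred1 true) k m; have := count_dev_ge0 (pred1 false) k m.
by case: b; rewrite -/(count_dev _ k m); lra.
Qed.

Lemma size_prefix_dev k m : (k <= n)%N ->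
  `|(size (mask (take k m) (take k x)))%:R - rho * k%:R| <= prefix_dev k m.
Proof.
move=> kn; rewrite /prefix_dev.
have := count_dev_ge0 (pred1 true) k m; have := count_dev_ge0 (pred1 false) k m.
by rewrite {3}/count_dev !count_predT (size_takel kn); lra.
Qed.

Lemma mask_prefix k m : size m = n -> (k <= n)%N ->
  mask (take k m) (take k x) = take (size (mask (take k m) (take k x))) (mask m x).
Proof.
move=> sm kn; have -> : mask m x =
    mask (take k m) (take k x) ++ mask (drop k m) (drop k x).
  by rewrite -mask_cat ?cat_take_drop // !size_takel // sm.
by rewrite take_size_cat.
Qed.

(** The image of the first [k] letters of [x] is a prefix of the trace whose length differs from
    [rho * k] by at most [prefix_dev]; the extra 1 is the rounding in [trace_index]. *)
Lemma trace_prefix_dist (f : seq bool -> nat) k m : size m = n -> (k <= n)%N ->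
  (forall s t, (f s <= f (s ++ t) <= f s + size t)%N) ->
  `|(f (take (trace_index k) (mask m x)))%:R -
    (f (mask (take k m) (take k x)))%:R| <= prefix_dev k m + 1.
Proof.
move=> sm kn hf; rewrite [in X in _ - X](mask_prefix sm kn).
apply: le_trans (take_lipschitz _ _ _ _ hf) _.
have h1 := size_prefix_dev m kn; have h2 := trace_index_dist k.
apply: le_trans (ler_distD (rho * k%:R) _ _) _.
by rewrite [X in _ + X]distrC addrC lerD.
Qed.

(** Counts in the trace estimate [rho] times counts in [x], so majorities read off the trace hold
    for [x] with errors divided by [rho]. Here [S] bounds from below the changes that the trace
    shows in the window, and [s] covers those still missing from the required [(3 * l - n) / 2]. *)
Lemma trace_window_bound p l b1 b3 m (S s : R) :
  let y := mask m x in
  size m = n -> (p + l <= n)%N -> 0 <= s ->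
  (size (take (trace_index p) y) <= 2 * count_mem b1 (take (trace_index p) y))%N ->
  (size (drop (trace_index (p + l)) y) <=
     2 * count_mem b3 (drop (trace_index (p + l)) y))%N ->
  S <= (changes (take (trace_index (p + l)) y))%:R -
       (changes (take (trace_index p) y))%:R ->
  (3 * l%:R - n%:R) / 2 <= S + s ->
  (n%:R + l%:R) / 2 - s -
    (4 * (prefix_dev p m + prefix_dev (p + l) m + prefix_dev n m) + 7) / rho <=
    (lcs (window_string n p l b1 b3) x)%:R.
Proof.
move=> y sm pl s0 M1 M3 HS Hs.
have pn : (p <= n)%N by lia.
have sizeL (u v : seq bool) : (size u <= size (u ++ v) <= size u + size v)%N.
  by rewrite size_cat; lia.
have countL b (u v : seq bool) :
    (count_mem b u <= count_mem b (u ++ v) <= count_mem b u + size v)%N.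
  by rewrite count_cat leq_addr leq_add2l count_size.
have changesL (u v : seq bool) :
    (changes u <= changes (u ++ v) <= changes u + size v)%N.
  rewrite changes_cat_size andbT; apply: changes_subseq; exact: prefix_subseq.
set q := (p + l)%N in pl M3 HS *.
set yp := mask (take p m) (take p x); set yq := mask (take q m) (take q x).
set dp := prefix_dev p m; set dq := prefix_dev q m; set dn := prefix_dev n m.
have dp0 : 0 <= dp := prefix_dev_ge0 p m.
have dq0 : 0 <= dq := prefix_dev_ge0 q m.
have dn0 : 0 <= dn := prefix_dev_ge0 n m.
have yn : mask (take n m) (take n x) = y by rewrite /n take_size -/n -sm take_size.
pose Z := rho^-1; have Z1 : 1 <= Z by rewrite invf_ge1.
have rZ : rho * Z = 1 by rewrite divff ?gt_eqF.
(* Inequalities about [x] are multiplied by [rho] to compare them with counts in the trace; the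
   error [d] returns as [d * Z]. *)
have scale (t d : R) : - d <= rho * t -> 0 <= t + d * Z.
  move=> h; rewrite -(pmulr_rge0 _ rho0) mulrDr [d * Z]mulrC mulrA rZ mul1r; lra.
have bnd (t d : R) : `|t| <= d -> (t <= d) /\ (- d <= t) by rewrite ler_norml => /andP[].
have [a1 a2] := bnd _ _ (size_prefix_dev m pn).
have [b1' b2] := bnd _ _ (size_prefix_dev m pl).
have := size_prefix_dev m (leqnn n); rewrite yn => /bnd[c1 c2].
have [d1 d2] := bnd _ _ (trace_prefix_dist sm pn sizeL).
have [f1 f2] := bnd _ _ (trace_prefix_dist sm pl sizeL).
rewrite -/y -/yp -/yq -/dp -/dq -/dn in a1 a2 b1' b2 c1 c2 d1 d2 f1 f2.
have E1 : p%:R / 2 <= (count_mem b1 (take p x))%:R + (3 * dp + 3 / 2) * Z.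
  have [g1 g2] := bnd _ _ (count_prefix_dev b1 p m).
  have [h1 h2] := bnd _ _ (trace_prefix_dist sm pn (countL b1)).
  move: M1; rewrite -(ler_nat R) natrM; rewrite -/y -/yp -/dp in g1 g2 h1 h2 *.
  move=> M1; rewrite -subr_ge0 addrAC; apply: scale; lra.
have E3 : (n%:R - p%:R - l%:R) / 2 <=
    (count_mem b3 (drop q x))%:R + (3 / 2 * dn + 3 * dq + 3 / 2) * Z.
  have [g1 g2] := bnd _ _ (count_prefix_dev b3 q m).
  have [h1 h2] := bnd _ _ (trace_prefix_dist sm pl (countL b3)).
  have := count_prefix_dev b3 n m; rewrite yn => /bnd[i1 i2].
  have j1 : rho * (count_mem b3 x)%:R =
      rho * (count_mem b3 (take q x))%:R + rho * (count_mem b3 (drop q x))%:R.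
    by rewrite -mulrDr -natrD -count_cat cat_take_drop.
  have j2 : (count_mem b3 y)%:R = (count_mem b3 (take (trace_index q) y))%:R +
       (count_mem b3 (drop (trace_index q) y))%:R :> R.
    by rewrite -natrD -count_cat cat_take_drop.
  have j3 : (size y)%:R = (size (take (trace_index q) y))%:R +
       (size (drop (trace_index q) y))%:R :> R.
    by rewrite -natrD -size_cat cat_take_drop.
  have j4 : rho * q%:R = rho * p%:R + rho * l%:R by rewrite -mulrDr -natrD.
  rewrite (take_size x : take n x = x) in i1 i2.
  move: M3; rewrite -(ler_nat R) natrM.
  rewrite -/y -/yp -/yq -/dp -/dq -/dn in g1 g2 h1 h2 i1 i2 *.
  move=> M3; rewrite -subr_ge0 addrAC; apply: scale; lra.
(* Deletions create no changes, so the changes in the trace bound those of the window without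
   division by [rho]. One change may sit at the seam behind the prefix. *)
have E2 : (3 * l%:R - n%:R) / 2 <=
    (changes (take l (drop p x)))%:R + (dp + dq + 3 + s).
  have [h1 h2] := bnd _ _ (trace_prefix_dist sm pn changesL).
  have [i1 i2] := bnd _ _ (trace_prefix_dist sm pl changesL).
  rewrite -/y -/yp -/yq -/dp -/dq in h1 h2 i1 i2.
  have : (changes yq <= changes yp + changes (take l (drop p x)) + 1)%N.
    have -> : yq = yp ++ mask (take l (drop p m)) (take l (drop p x)).
      by rewrite /yq /q !takeD mask_cat // !size_takel // sm.
    apply: leq_trans (changes_cat_le _ _) _.
    rewrite leq_add2r leq_add2l; exact/changes_subseq/mask_subseq.
  by rewrite -(ler_nat R) !natrD; lra.
have := lcs_window_string pl _ _ _ E1 E2 E3.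
have P1 : 0 <= (3 * dp + 3 / 2) * Z by apply: mulr_ge0; lra.
have P3 : 0 <= (3 / 2 * dn + 3 * dq + 3 / 2) * Z by apply: mulr_ge0; lra.
have P2 : 0 <= dp + dq + 3 + s by lra.
move=> /(_ P1 P2 P3); apply: le_trans; rewrite -/Z -/n.
have Q (d : R) : 0 <= d -> d <= d * Z by move=> d0; rewrite ler_peMr.
have := Q _ dp0; have := Q _ dq0; have := Q _ dn0.
move: Z1 dn0; clearbody dp dq dn; clear; lra.
Qed.
End Deviations.

(** * Majority letters and the two-thirds bound *)

Lemma size_count_bool (b : bool) (s : seq bool) :
  size s = (count_mem b s + count_mem (~~ b) s)%N.
Proof. by elim: s => //= c s ->; case: b; case: c => /=; lia. Qed.

Lemma majority (s : seq bool) : exists b, (size s <= 2 * count_mem b s)%N.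
Proof.
have h := size_count_bool true s; rewrite /= in h.
have [ft|tf] := leqP (count_mem false s) (count_mem true s).
  by exists true; rewrite h mul2n -addnn leq_add2l.
by exists false; rewrite h mul2n -addnn leq_add2r ltnW.
Qed.

Lemma L1worst_ge_two_thirds (R : realType) (rho : R) n : 0 < rho -> rho <= 1 -> (0 < n)%N ->
  2 / 3 * n%:R - (36 * Num.sqrt (rho * n%:R) + 8) / rho <= L1worst (1 - rho) n.
Proof.
(* One third of [n], rounded up: [(n + l) / 2] reaches [2 n / 3], while [(3 * l - n) / 2] is at most
   1 and is covered by slack 1, with no change demanded of [x]. *)
move=> rho0 rho1 n0; pose l := ((n + 2) %/ 3)%N.
have ln : (0 + l <= n)%N by rewrite /l; lia.
have ln1 : (n <= 3 * l)%N by rewrite /l; lia.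
have ln2 : (3 * l <= n + 2)%N by rewrite /l; lia.
have /choice[D hD] (y : seq bool) : exists z : n.-tuple bool, exists b1 b3,
    [/\ z = window_string n 0 l b1 b3 :> seq bool,
     (size (take (trace_index rho 0) y) <= 2 * count_mem b1 (take (trace_index rho 0) y))%N &
     (size (drop (trace_index rho l) y) <= 2 * count_mem b3 (drop (trace_index rho l) y))%N].
  have [b1 h1] := majority (take (trace_index rho 0) y).
  have [b3 h3] := majority (drop (trace_index rho l) y).
  have sz := size_window_string b1 b3 ln.
  by exists (Tuple (introT eqP sz)), b1, b3.
apply: (@L1worst_ge R rho n D) => x.
pose P := prefix_dev rho x.
apply: (@le_trans _ _ (mask_expect rho n (fun m =>
    (n%:R + l%:R) / 2 - 1 - 7 / rho + (- (4 / rho)) * (P 0%N m + (P l m + P n m))))).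
  have E k : (k <= n)%N -> mask_expect rho n (P k) <= 3 * Num.sqrt (rho * n%:R).
    by rewrite -{1 2 3}(size_tuple x); exact: prefix_dev_expect.
  clearbody P; rewrite mask_expectD mask_expectZ mask_expectD mask_expectD mask_expect_cst.
  have {}E : (4 / rho) * (mask_expect rho n (P 0%N) + (mask_expect rho n (P l) + mask_expect rho n (P n)))
      <= (4 / rho) * (9 * Num.sqrt (rho * n%:R)).
    apply: ler_wpM2l; first by rewrite divr_ge0 // ltW.
    by have := E _ (leq0n n); have := E _ ln; have := E _ (leqnn n); lra.
  have Z1 : 1 <= rho^-1 by rewrite invf_ge1.
  move: ln1; rewrite -(ler_nat R) natrM => ln1.
  by rewrite mulNr; lra.
apply: mask_expect_le => [||m sm]; [exact: ltW|exact: rho1|].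
have [b1 [b3 [-> M1 M3]]] := hD (mask m x).
have sx : size x = n := size_tuple x.
have := @trace_window_bound R rho rho0 rho1 x 0 l b1 b3 m 0 1.
rewrite sx => /(_ sm ln ler01 M1 M3); rewrite -/P.
have -> : trace_index rho 0 = 0%N by rewrite /trace_index mulr0 truncn0.
rewrite take0 subr0 add0r ler0n => /(_ isT).
have h : (3 * l%:R - n%:R) / 2 <= 1 :> R.
  by move: ln2; rewrite -(ler_nat R) natrM natrD; lra.
by move=> /(_ h); apply: le_trans; rewrite add0n; lra.
Qed.

(** * The stretching strategy *)

Definition stretch w (y : seq bool) : seq bool := flatten [seq nseq w b | b <- y].

Lemma stretch_cat w s t : stretch w (s ++ t) = stretch w s ++ stretch w t.
Proof. by rewrite /stretch map_cat flatten_cat. Qed.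

Lemma count_stretch a w s : count a (stretch w s) = (w * count a s)%N.
Proof.
elim: s => [|b s IH] /=; first by rewrite muln0.
by rewrite /stretch /= count_cat -/(stretch w s) IH count_nseq; lia.
Qed.

Lemma size_stretch w s : size (stretch w s) = (w * size s)%N.
Proof. by rewrite -!count_predT count_stretch. Qed.

Lemma lcs_stretch (b : bool) w y x :
  (minn (w * count_mem b y) (count_mem b x) <= lcs (stretch w y) x)%N.
Proof.
apply: leq_trans (lcs_nseq b _ x) (lcs_sub _ (subseq_refl x)).
by apply: subseq_nseq; rewrite count_stretch.
Qed.

(** A rational substitute for the exponential bound on the probability that [a] given letters are
    all deleted. *)
Lemma bernoulli_inverse (R : realType) (rho : R) a : 0 <= rho -> rho <= 1 ->
  (1 - rho) ^+ a * (1 + a%:R * rho) <= 1.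
Proof.
move=> r0 r1; elim: a => [|a IH]; first by rewrite expr0 mul0r addr0 mulr1.
apply: le_trans IH; rewrite exprS -[a.+1]addn1 natrD.
rewrite [(1 - rho) * _]mulrC -mulrA; apply: ler_wpM2l.
  by rewrite exprn_ge0 // subr_ge0.
have := ler0n R a; nra.
Qed.

(** For [t = rho * W] this makes the standard deviation of a letter count in a block at most
    [rho * W / 100]. *)
Lemma le_hundredth_sqr (R : realType) (t : R) : 100 * 100 <= t -> t <= (t / 100) ^+ 2.
Proof. by move=> t1; have : 0 <= t * (t - 100 * 100) by [apply: mulr_ge0; lra]; lra. Qed.

(** The left-hand side is the probability that both letters survive, by inclusion and exclusion:
    both are absent only from the empty trace. A trace with both letters has a change. *)
Lemma mask_changes_ge (R : realType) (rho : R) (b : bool) (x : seq bool) :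
  0 <= rho -> rho <= 1 ->
  (1 - (1 - rho) ^+ count_mem b x) * (1 - (1 - rho) ^+ count_mem (~~ b) x) <=
  mask_expect rho (size x) (fun m => (changes (mask m x))%:R).
Proof.
move=> r0 rho1; have sz := size_count_bool b x.
have -> : (1 - (1 - rho) ^+ count_mem b x) * (1 - (1 - rho) ^+ count_mem (~~ b) x) =
  mask_expect rho (size x) (fun m => 1 - (b \notin mask m x)%:R +
    (-1 * (~~ b \notin mask m x)%:R + (mask m x == [::])%:R)).
  rewrite mask_expectD (mask_expectB r0 rho1) mask_expectD mask_expectZ mask_expect_cst.
  by rewrite !mask_notin // mask_nil // sz exprD; ring.
apply: mask_expect_le => // m _; set y := mask m x.
case: (boolP (b \in y)) => h1; case: (boolP (~~ b \in y)) => h2 /=.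
- have := changes_ge1 h1 h2; rewrite -(ler_nat R).
  have -> : (y == [::]) = false by case: (y) h1.
  by rewrite /=; lra.
- have -> : (y == [::]) = false by case: (y) h1.
  by have := ler0n R (changes y); rewrite /=; lra.
- have -> : (y == [::]) = false by case: (y) h2.
  by have := ler0n R (changes y); rewrite /=; lra.
by have := ler0n R (changes y); have := lern1 R (y == [::]); case: (y == [::]) => /=; lra.
Qed.

(* A block with many minority letters shows changes in its trace with constant
   probability; otherwise matching its majority letter alone is nearly optimal. *)
Lemma lcs_stretch_block (R : realType) (rho kappa : R) (w W : nat) (x : seq bool) :
  0 < rho -> rho <= 1 -> 0 <= kappa -> kappa <= 1 -> kappa <= w%:R * rho ->
  100 * 100 <= rho * W%:R -> rho * W%:R <= 101 * 100 ->
  size x = W ->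
  kappa * (99 / 100 * W%:R - 204 * 100 / rho *
     mask_expect rho (size x) (fun m => (changes (mask m x))%:R)) <=
  mask_expect rho (size x) (fun m => (lcs (stretch w (mask m x)) x)%:R).
Proof.
move=> rho0 rho1 kappa0 kappa1 kappaw W0 W1 sx; have r0 := ltW rho0.
have [b hb] := majority x.
set E := mask_expect rho (size x) (fun m => (changes (mask m x))%:R).
have sz := size_count_bool b x.
have := mask_changes_ge b x r0 rho1; rewrite -/E.
set a := count_mem b x in hb sz *; set c := count_mem (~~ b) x in sz *.
set A : R := (1 - rho) ^+ a; set C : R := (1 - rho) ^+ c => hE.
have HA : A * (1 + a%:R * rho) <= 1 := bernoulli_inverse a r0 rho1.
have HC : C * (1 + c%:R * rho) <= 1 := bernoulli_inverse c r0 rho1.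
have WE : W%:R = a%:R + c%:R :> R by rewrite -natrD -sz sx.
have aW : W%:R <= 2 * a%:R :> R by rewrite -natrM ler_nat -sx.
have a0 : 0 <= a%:R :> R := ler0n _ _.
have c0 : 0 <= c%:R :> R := ler0n _ _.
have A0 : 0 <= A by rewrite exprn_ge0 // subr_ge0.
have C0 : 0 <= C by rewrite exprn_ge0 // subr_ge0.
have CL1 : C <= 1 by apply: exprn_ile1; rewrite ?subr_ge0 // lerBlDr lerDl.
clearbody A C.
have A2 : A <= 1 / 2.
  have : 1 <= a%:R * rho
    by have := le_trans W0 (ler_wpM2l r0 aW); lra.
  move=> h; have : A * 1 <= A * (a%:R * rho) by exact: ler_wpM2l.
  by lra.
(* Bernoulli gives [c * rho <= (1 - C) * (1 + c * rho)], and [c * rho <= rho * W] bounds the last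
   factor by 102 * 100. The bound [A <= 1 / 2] then doubles this constant. *)
have C1 : c%:R * rho <= (1 - C) * (102 * 100).
  have h : c%:R * rho <= (1 - C) * (1 + c%:R * rho) by lra.
  apply: le_trans h _; apply: ler_wpM2l; first by rewrite subr_ge0.
  have h : c%:R * rho <= rho * W%:R by rewrite mulrC ler_wpM2l // WE lerDr.
  by have := le_trans h W1; clear; lra.
have C2 : c%:R * rho <= 204 * 100 * E.
  have C1' : 0 <= 1 - C by rewrite subr_ge0.
  have : 1 / 2 * (1 - C) <= (1 - A) * (1 - C) by apply: ler_wpM2r; lra.
  by lra.
have {C1 C2} cE : c%:R <= 204 * 100 / rho * E by rewrite mulrAC ler_pdivlMr.
pose d (m : seq bool) : R := `|(count_mem b (mask m x))%:R - rho * a%:R|.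
have dE : mask_expect rho (size x) d <= rho * W%:R / 100.
  apply: le_trans (mask_count_deviation r0 rho1 _ (lexx _)) _.
  rewrite sx; have t0 : 0 <= rho * W%:R := mulr_ge0 r0 (ler0n _ _).
  by rewrite -(@ler_sqr R) ?nnegrE ?sqrtr_ge0 ?divr_ge0 // sqr_sqrtr //; exact: le_hundredth_sqr.
(* For every mask, both terms of the minimum in [lcs_stretch] are at least
   [kappa * a - kappa / rho * d m], as [kappa] is at most 1 and at most [w * rho]. *)
apply: (@le_trans _ _ (mask_expect rho (size x) (fun m => kappa * a%:R + (- (kappa / rho)) * d m))).
  rewrite mask_expectD mask_expect_cst mask_expectZ.
  have : kappa / rho * mask_expect rho (size x) d <= kappa / rho * (rho * W%:R / 100).
    by apply: ler_wpM2l => //; rewrite divr_ge0 ?mulr_ge0 ?ler0n.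
  have -> : kappa / rho * (rho * W%:R / 100) = kappa * W%:R / 100.
    by field; rewrite gt_eqF.
  have := ler_wpM2l kappa0 cE; rewrite mulNr WE; clear; lra.
apply: mask_expect_le => // m _.
have := lcs_stretch b w (mask m x); rewrite -/a => /(_ x).
pose z := count_mem b (mask m x); rewrite -/z -(ler_nat R); apply: le_trans.
have dz : 0 <= d m := normr_ge0 _.
have d1 : rho * a%:R - d m <= z%:R.
  by have := ler_norm (rho * a%:R - z%:R); rewrite distrC -/(d m); clear; lra.
have kr : 0 <= kappa / rho by rewrite divr_ge0.
rewrite /minn; case: ifP => _.
  apply: (@le_trans _ _ (kappa / rho * z%:R)).
    have := ler_wpM2l kr d1; rewrite mulrBr mulrA divfK ?gt_eqF //; clear; lra.
  by rewrite natrM; apply: ler_wpM2r => //; rewrite ler_pdivrMr.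
have : kappa * a%:R <= a%:R by rewrite ler_piMl.
have := mulr_ge0 kr dz; clear; lra.
Qed.

(** Sums the block bound over consecutive blocks of length [W]: common subsequences and changes are
    both superadditive under concatenation. A last block shorter than [W] is given up. *)
Lemma lcs_stretch_expect (R : realType) (rho kappa : R) (w W : nat) (x : seq bool) :
  0 < rho -> rho <= 1 -> 0 <= kappa -> kappa <= 1 -> kappa <= w%:R * rho ->
  100 * 100 <= rho * W%:R -> rho * W%:R <= 101 * 100 ->
  kappa * (99 / 100 * ((size x)%:R - W%:R) - 204 * 100 / rho *
     mask_expect rho (size x) (fun m => (changes (mask m x))%:R)) <=
  mask_expect rho (size x) (fun m => (lcs (stretch w (mask m x)) x)%:R).
Proof.
move=> rho0 rho1 kappa0 kappa1 kappaw W0 W1; have r0 := ltW rho0.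
have [N] := ubnP (size x); elim: N x => // N IH x; rewrite ltnS => xN.
have Wpos : (0 < W)%N.
  by case: (W) W0 => //; rewrite mulr0; lra.
have ch0 (z : seq bool) : 0 <= 204 * 100 / rho * mask_expect rho (size z) (fun m => (changes (mask m z))%:R).
  by rewrite mulr_ge0 ?divr_ge0 ?mulr_ge0 ?ler0n //; apply: mask_expect_ge0.
have [xW|Wx] := ltnP (size x) W.
  apply: (@le_trans _ _ 0); last exact: mask_expect_ge0.
  rewrite mulr_ge0_le0 //; have := ch0 x.
  move: (ltnW xW); rewrite -(ler_nat R); clear; lra.
rewrite -(cat_take_drop W x); set x1 := take W x; set x2 := drop W x.
have s1 : size x1 = W by rewrite size_takel.
have s2 : (size x2 < N)%N by rewrite size_drop; lia.
have h1 := lcs_stretch_block rho0 rho1 kappa0 kappa1 kappaw W0 W1 s1; have h2 := IH _ s2.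
rewrite size_cat !mask_expect_cat.
set E1 := mask_expect rho (size x1) _ in h1; set E2 := mask_expect rho (size x2) _ in h2.
set F1 := mask_expect rho (size x1) _ in h1; set F2 := mask_expect rho (size x2) _ in h2.
have cE : E1 + E2 <= mask_expect rho (size x1) (fun m1 => mask_expect rho (size x2)
    (fun m2 => (changes (mask (m1 ++ m2) (x1 ++ x2)))%:R)).
  rewrite -[E2](mask_expect_cst rho (size x1)) -mask_expectD; apply: mask_expect_le => // m1 sm1.
  rewrite -[X in X + _](mask_expect_cst rho (size x2)) -mask_expectD; apply: mask_expect_le => // m2 _.
  by rewrite mask_cat // -natrD ler_nat changes_cat_ge.
have cF : F1 + F2 <= mask_expect rho (size x1) (fun m1 => mask_expect rho (size x2)
    (fun m2 => (lcs (stretch w (mask (m1 ++ m2) (x1 ++ x2))) (x1 ++ x2))%:R)).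
  rewrite -[F2](mask_expect_cst rho (size x1)) -mask_expectD; apply: mask_expect_le => // m1 sm1.
  rewrite -[X in X + _](mask_expect_cst rho (size x2)) -mask_expectD; apply: mask_expect_le => // m2 _.
  by rewrite mask_cat // stretch_cat -natrD ler_nat lcs_cat.
apply: le_trans cF; apply: le_trans (lerD h1 h2); rewrite -mulrDr; apply: ler_wpM2l => //.
have r1 : 0 <= 204 * 100 / rho by rewrite divr_ge0 ?mulr_ge0 ?ler0n.
have := ler_wpM2l r1 cE; rewrite natrD s1; clear; lra.
Qed.

(* Rounding [1 / rho] to an integer [w] loses a constant factor when [rho] is
   large: either only a fraction [kappa] of [x] is covered, or the stretched trace
   is too long and only the first [q] letters of [x] count.  Rounding [0.7 / rho]
   up keeps the loss at most 3/10 in both cases. *)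
Lemma stretch_parameters (R : realType) (rho : R) n : 0 < rho -> rho <= 1 ->
  exists w q : nat, exists kappa : R, [/\ 0 <= kappa, kappa <= 1,
    kappa <= w%:R * rho, w%:R * rho <= 2 & [/\ (q <= n)%N, w%:R * rho * q%:R <= n%:R &
    7 / 10 * n%:R - 1 <= kappa * q%:R]].
Proof.
move=> r0 r1; have n0 := ler0n R n.
have [r7|r7] := lerP (7 / 10) rho.
  exists 1%N, n, rho; rewrite mul1r; split; [lra|lra|lra|lra|split => //].
    by rewrite ler_piMl.
  have : 7 / 10 * n%:R <= rho * n%:R by exact: ler_wpM2r.
  by lra.
pose w := (Num.truncn (7 / 10 / rho)).+1; pose tau := w%:R * rho.
have /truncn_itv/andP[] : 0 <= 7 / 10 / rho by rewrite divr_ge0 // ltW.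
rewrite ler_pdivlMr // ltr_pdivrMr // -/w -/tau => h1 h2.
have h3 : tau <= 14 / 10 by rewrite /tau /w -natr1 mulrDl; lra.
have [t1|t1] := lerP tau 1.
  exists w, n, tau; split; [lra|lra|by rewrite lexx|rewrite -/tau; lra|split => //].
    by rewrite -/tau ler_piMl.
  have : 7 / 10 * n%:R <= tau * n%:R by apply: ler_wpM2r => //; exact: ltW.
  by lra.
have tau0 : 0 < tau by lra.
have /truncn_itv/andP[] : 0 <= n%:R / tau by rewrite divr_ge0 // ltW.
rewrite ler_pdivlMr // ltr_pdivrMr // => g1 g2.
(* Since [tau <= 14 / 10] and 10/14 exceeds 7/10, the quotient [n / tau] is at least [7 n / 10];
   truncation loses at most 1. *)
exists w, (Num.truncn (n%:R / tau)), 1; rewrite -/tau; split; [lra|lra|lra|lra|split].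
- rewrite -(ler_nat R); apply: le_trans g1; rewrite ler_peMr //; exact: ltW.
- by rewrite mulrC.
rewrite mul1r; move: g2; rewrite -natr1; have := ler0n R (Num.truncn (n%:R / tau)).
set k := _%:R => k0 g2; nra.
Qed.

(** The output must have exactly [n] letters: a long stretched trace is cut, a short one is padded
    with arbitrary letters. *)
Definition padded_stretch n w (y : seq bool) : seq bool :=
  take n (stretch w y ++ nseq n false).

Lemma size_padded_stretch n w y : size (padded_stretch n w y) = n.
Proof. by rewrite size_takel // size_cat size_nseq; lia. Qed.

(* The penalty pays for the letters that [padded_stretch] cuts off. *)
Definition stretch_score (R : realType) (rho : R) w (x m : seq bool) : R :=
  (lcs (stretch w (mask m x)) x)%:R -
  w%:R * `|(size (mask m x))%:R - rho * (size x)%:R|.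

(** One more letter in the trace adds [w] stretched letters, which changes the common subsequence by
    at most [w] and the penalty by at most [w]. *)
Lemma stretch_score_lipschitz (R : realType) (rho : R) w (x : seq bool) :
  mask_lipschitz (size x) (2 * w%:R) (stretch_score rho w x).
Proof.
move=> s1 s2 e; have [x1 [c [x2 [_ [_ [_ hb]]]]]] := mask_split e.
rewrite /stretch_score !hb /=.
set y1 := mask s1 x1; set y2 := mask s2 x2; set k := rho * _.
have hl : (lcs (stretch w (y1 ++ y2)) x <= lcs (stretch w (y1 ++ [:: c] ++ y2)) x)%N.
  rewrite !stretch_cat; apply: lcs_sub => //; apply: cat_subseq => //.
  exact: suffix_subseq.
have hu : (lcs (stretch w (y1 ++ [:: c] ++ y2)) x <= lcs (stretch w (y1 ++ y2)) x + w)%N.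
  rewrite !stretch_cat; have := lcs_insert (stretch w y1) (stretch w [:: c]) (stretch w y2) x.
  by rewrite size_stretch /= muln1.
rewrite cat1s -!(ler_nat R) natrD in hl hu.
set L1 : R := (lcs (stretch w (y1 ++ y2)) x)%:R in hl hu *.
set L2 : R := (lcs (stretch w (y1 ++ c :: y2)) x)%:R in hl hu *.
have -> : (size (y1 ++ c :: y2))%:R = (size (y1 ++ y2))%:R + 1 :> R.
  by rewrite !size_cat /= addnS natr1.
set z : R := (size (y1 ++ y2))%:R.
have : `| `|z + 1 - k| - `|z - k| | <= 1.
  apply: le_trans (ler_dist_dist _ _) _.
  by rewrite (_ : _ - _ = 1) ?normr1 //; ring.
move=> h; have h' : `|w%:R * (`|z + 1 - k| - `|z - k|)| <= w%:R.
  by rewrite normrM normr_nat ler_piMr.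
have -> : L2 - w%:R * `|z + 1 - k| - (L1 - w%:R * `|z - k|) =
  (L2 - L1) - w%:R * (`|z + 1 - k| - `|z - k|) by ring.
apply: le_trans (ler_normB _ _) _.
have : `|L2 - L1| <= w%:R by rewrite ger0_norm ?subr_ge0 //; lra.
by lra.
Qed.

(** When the stretched trace [y] of the first [q] letters exceeds [n = size x], the [w * size y - n]
    letters cut off are at most the penalty [w * (size y - rho * q)], as [w * rho * q <= n]. *)
Lemma stretch_score_le (R : realType) (rho : R) w q (x m : seq bool) :
  size m = size x -> (q <= size x)%N ->
  w%:R * rho * q%:R <= (size x)%:R ->
  stretch_score rho w (take q x) (take q m) <=
    (lcs (padded_stretch (size x) w (mask m x)) x)%:R.
Proof.
move=> sm qn wq; rewrite /stretch_score size_takel //.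
set y := mask (take q m) (take q x); set n := size x in qn wq sm *.
have yE : mask m x = y ++ mask (drop q m) (drop q x).
  by rewrite -mask_cat ?cat_take_drop // !size_takel // sm.
have h1 : (lcs (take n (stretch w y)) (take q x) <= lcs (padded_stretch n w (mask m x)) x)%N.
  apply: lcs_sub; last exact: take_subseq.
  rewrite /padded_stretch yE stretch_cat -catA.
  rewrite [take n (_ ++ _)]take_cat; case: ltnP => h //.
  by rewrite take_oversize // prefix_subseq.
have := lcs_insert (take n (stretch w y)) (drop n (stretch w y)) [::] (take q x).
rewrite !cats0 cat_take_drop size_drop size_stretch => h2.
have D0 : 0 <= w%:R * `|(size y)%:R - rho * q%:R| by rewrite mulr_ge0.
have D1 : w%:R * ((size y)%:R - rho * q%:R) <= w%:R * `|(size y)%:R - rho * q%:R|.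
  by rewrite ler_wpM2l // ler_norm.
have [h|h] := leqP (w * size y) n.
  have : (lcs (stretch w y) (take q x) <= lcs (padded_stretch n w (mask m x)) x)%N by lia.
  by rewrite -(ler_nat R); lra.
have : (lcs (stretch w y) (take q x) + n <=
   lcs (padded_stretch n w (mask m x)) x + w * size y)%N by lia.
rewrite -(ler_nat R) !natrD natrM; lra.
Qed.

(** The block bound is applied to the first [q] letters of [x], whose trace has no more changes than
    the whole trace. The mean penalty is at most [2 / rho] times the root of [rho * n]. *)
Lemma stretch_score_expect (R : realType) (rho : R) w W q (kappa T : R) (x : seq bool) :
  0 < rho -> rho <= 1 -> 0 <= kappa -> kappa <= 1 -> kappa <= w%:R * rho -> w%:R * rho <= 2 ->
  100 * 100 <= rho * W%:R -> rho * W%:R <= 101 * 100 -> (q <= size x)%N ->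
  7 / 10 * (size x)%:R - 1 <= kappa * q%:R ->
  mask_expect rho (size x) (fun m => (changes (mask m x))%:R) <= T ->
  99 / 100 * (7 / 10 * (size x)%:R - 1) - (101 * 100 + 204 * 100 * T +
     2 * Num.sqrt (rho * (size x)%:R)) / rho <=
  mask_expect rho q (stretch_score rho w (take q x)).
Proof.
move=> rho0 rho1 k0 k1 kw w2 W0 W1 qn kq ET; have r0 := ltW rho0; set n := size x in qn kq ET *.
have sq : size (take q x) = q by rewrite size_takel.
have := lcs_stretch_expect (take q x) rho0 rho1 k0 k1 kw W0 W1; rewrite sq.
set E1 := mask_expect _ _ _; set F := mask_expect _ _ _ => hF.
have T0 : 0 <= T by apply: le_trans ET; apply: mask_expect_ge0.
have E1T : E1 <= T.
  apply: le_trans ET.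
  rewrite /E1 -(mask_expect_take r0 rho1 (fun m => (changes (mask m (take q x)))%:R) qn).
  apply: mask_expect_le => // m sm; rewrite ler_nat; apply: changes_subseq.
  rewrite -{2}(cat_take_drop q m) -{2}(cat_take_drop q x) mask_cat ?prefix_subseq //.
  by rewrite !size_takel // sm.
have -> : mask_expect rho q (stretch_score rho w (take q x)) = F - w%:R *
    mask_expect rho q (fun m => `|(size (mask m (take q x)))%:R - rho * q%:R|).
  rewrite -mask_expectZ -(mask_expectB r0 rho1); apply: eq_mask_expect => // m _.
  by rewrite /stretch_score sq.
have hD : mask_expect rho q (fun m => `|(size (mask m (take q x)))%:R - rho * q%:R|) <=
    Num.sqrt (rho * n%:R).
  have := @mask_count_deviation R rho r0 rho1 predT (take q x) n%:R.
  rewrite sq ler_nat => /(_ qn); rewrite count_predT sq.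
  by apply: le_trans; apply: mask_expect_le.
have {hD} hD := ler_wpM2l (ler0n R w) hD.
have wZ : w%:R <= 2 / rho by rewrite ler_pdivlMr.
have sZ := ler_wpM2r (sqrtr_ge0 (rho * n%:R)) wZ.
have WZ : W%:R <= 101 * 100 / rho by rewrite ler_pdivlMr // mulrC.
have kW : kappa * W%:R <= W%:R by rewrite ler_piMl.
have EZ : kappa * (204 * 100 / rho * E1) <= 204 * 100 / rho * T.
  apply: (@le_trans _ _ (204 * 100 / rho * E1)).
    by rewrite ler_piMl // mulr_ge0 ?divr_ge0 ?mulr_ge0 ?ler0n ?mask_expect_ge0.
  by apply: ler_wpM2l => //; rewrite divr_ge0 ?mulr_ge0 ?ler0n.
move: hF hD sZ EZ; set s := Num.sqrt _; rewrite mulrBr => hF hD sZ EZ.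
have hF' : 99 / 100 * (kappa * q%:R) - 99 / 100 * (kappa * W%:R) - kappa * (204 * 100 / rho * E1) <= F.
  by apply: le_trans hF; rewrite lerD2r; clear; lra.
set D := mask_expect _ _ _ in hD *.
have kW0 : 0 <= kappa * W%:R by rewrite mulr_ge0.
have -> : (101 * 100 + 204 * 100 * T + 2 * s) / rho =
    101 * 100 / rho + 204 * 100 / rho * T + 2 / rho * s by ring.
move: hF' hD sZ EZ kq kW WZ kW0; clear.
set a1 := kappa * W%:R; set a2 := kappa * q%:R; set a3 := kappa * _.
set a4 := w%:R * D; set a5 := w%:R * s; set a6 := 2 / rho * s.
set a7 := 204 * 100 / rho * T; set a8 := 101 * 100 / rho; set a9 : R := W%:R.
move: a1 a2 a3 a4 a5 a6 a7 a8 a9 => a1 a2 a3 a4 a5 a6 a7 a8 a9.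
lra.
Qed.

(** * Combining the strategies *)

(** The windows starting at 0, [l] and [n - l] cover everything because [n <= 3 * l], so one of them
    shows at least a third of the changes. *)
Lemma window_choice (R : realType) (rho : R) n l (y : seq bool) : 0 <= rho ->
  (2 * l <= n)%N -> (n <= 3 * l)%N ->
  exists2 p, p \in [:: 0; l; n - l]%N &
    (changes (take (trace_index rho n) y) + 3 * changes (take (trace_index rho p) y) <=
     3 * changes (take (trace_index rho (p + l)) y))%N.
Proof.
move=> r0 l2 l3; pose c k := changes (take (trace_index rho k) y).
have c_mono j k : (j <= k)%N -> (c j <= c k)%N.
  move=> jk; have ijk : (trace_index rho j <= trace_index rho k)%N.
    by apply: le_truncn; apply: ler_wpM2l => //; rewrite ler_nat.
  apply: changes_subseq; rewrite -(subnKC ijk) takeD; exact: prefix_subseq.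
have c0 : c 0%N = 0%N by rewrite /c /trace_index mulr0 truncn0 take0.
have h1 : (c (n - l) <= c (l + l))%N by apply: c_mono; lia.
have h2 : c (n - l + l)%N = c n by congr c; lia.
have [g0|g0] := leqP (c n) (3 * c l).
  by exists 0%N; rewrite ?mem_head // -/(c _) -/(c _) -/(c _) add0n c0; lia.
have [g1|g1] := leqP (c n + 3 * c l) (3 * c (l + l)%N).
  by exists l => //; rewrite !inE eqxx orbT.
exists (n - l)%N; first by rewrite !inE eqxx !orbT.
by rewrite -/(c _) -/(c _) -/(c _) h2; lia.
Qed.

(** Every clause refers to the trace [y] and the output [z] only, so that [z] can be chosen without
    knowing the input. *)
Definition good_window (R : realType) (rho : R) n l (y z : seq bool) := exists p, exists b1 b3,
  [/\ p \in [:: 0; l; n - l]%N, z = window_string n p l b1 b3,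
     (size (take (trace_index rho p) y) <= 2 * count_mem b1 (take (trace_index rho p) y))%N,
     (size (drop (trace_index rho (p + l)) y) <=
       2 * count_mem b3 (drop (trace_index rho (p + l)) y))%N &
    (changes (take (trace_index rho n) y) + 3 * changes (take (trace_index rho p) y) <=
     3 * changes (take (trace_index rho (p + l)) y))%N].

Lemma good_window_exists (R : realType) (rho : R) n l (y : seq bool) : 0 <= rho ->
  (2 * l <= n)%N -> (n <= 3 * l)%N -> exists z, good_window rho n l y z.
Proof.
move=> r0 l2 l3; have [p pin hp] := window_choice y r0 l2 l3.
have [b1 h1] := majority (take (trace_index rho p) y).
have [b3 h3] := majority (drop (trace_index rho (p + l)) y).
by exists (window_string n p l b1 b3), p, b1, b3.
Qed.

Lemma size_good_window (R : realType) (rho : R) n l (y z : seq bool) :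
  (2 * l <= n)%N -> good_window rho n l y z -> size z = n.
Proof.
move=> l2 [p [b1 [b3 [pin -> _ _ _]]]]; apply: size_window_string.
by move: pin l2; rewrite !inE => /or3P[] /eqP ->; lia.
Qed.

(** All endpoints of the three candidate windows are included, so bounds do not depend on which
    window the trace selects. *)
Definition window_dev (R : realType) (rho : R) n l (x m : seq bool) : R :=
  prefix_dev rho x 0 m + (prefix_dev rho x l m + (prefix_dev rho x (l + l) m +
   (prefix_dev rho x (n - l) m + prefix_dev rho x n m))).

Lemma window_dev_ge0 (R : realType) (rho : R) n l (x m : seq bool) :
  0 <= window_dev rho n l x m.
Proof. by rewrite /window_dev /prefix_dev !addr_ge0 ?count_dev_ge0. Qed.

Lemma window_dev_expect (R : realType) (rho : R) n l (x : seq bool) :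
  0 < rho -> rho <= 1 -> (2 * l <= n)%N -> size x = n ->
  mask_expect rho n (window_dev rho n l x) <= 15 * Num.sqrt (rho * n%:R).
Proof.
move=> rho0 rho1 l2 sx; rewrite /window_dev.
have h k : (k <= n)%N -> mask_expect rho n (prefix_dev rho x k) <= 3 * Num.sqrt (rho * n%:R).
  by rewrite -sx; exact: prefix_dev_expect.
have := h _ (leq0n n); have := h l; have := h (l + l)%N; have := h (n - l)%N.
have := h n (leqnn n).
have -> : (l <= n)%N by lia.
have -> : (l + l <= n)%N by lia.
have -> : (n - l <= n)%N by lia.
do 4 rewrite mask_expectD.
move=> h1 /(_ isT) h2 /(_ isT) h3 /(_ isT) h4 h5; lra.
Qed.

(** The chosen window shows a third of the changes up to [trace_index rho n]. Cutting the trace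
    there instead of at its end loses at most [prefix_dev rho x n m + 1] changes, a third of which
    becomes the slack. *)
Lemma good_window_lcs (R : realType) (rho : R) n l (T : R) (x m z : seq bool) :
  0 < rho -> rho <= 1 -> (2 * l <= n)%N -> (3 * l%:R - n%:R) / 2 <= T / 3 ->
  size x = n -> size m = n ->
  good_window rho n l (mask m x) z -> T <= (changes (mask m x))%:R ->
  (n%:R + l%:R) / 2 - 1 / 3 - (9 * window_dev rho n l x m + 7) / rho <= (lcs z x)%:R.
Proof.
move=> rho0 rho1 l2 lT sx sm [p [b1 [b3 [pin -> M1 M3 hc]]]] Ty.
have D k : 0 <= prefix_dev rho x k m := prefix_dev_ge0 rho x k m.
have pl : (p + l <= n)%N by move: pin l2; rewrite !inE => /or3P[] /eqP ->; lia.
have changesL (u v : seq bool) :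
    (changes u <= changes (u ++ v) <= changes u + size v)%N.
  rewrite changes_cat_size andbT; apply: changes_subseq; exact: prefix_subseq.
pose S : R := (changes (take (trace_index rho (p + l)) (mask m x)))%:R -
  (changes (take (trace_index rho p) (mask m x)))%:R.
have hS : T - prefix_dev rho x n m - 1 <= 3 * S.
  have := @trace_prefix_dist R rho rho0 x changes n m.
  rewrite sx => /(_ sm (leqnn n) changesL).
  rewrite (@take_oversize _ n m) ?sm // (@take_oversize _ n x) ?sx // ler_norml => /andP[g1 _].
  move: hc; rewrite -(ler_nat R) natrD !natrM; move: g1 Ty; rewrite /S; clear; lra.
have s0 : 0 <= (prefix_dev rho x n m + 1) / 3.
  by have := D n; clear; lra.
have := @trace_window_bound R rho rho0 rho1 x p l b1 b3 m S ((prefix_dev rho x n m + 1) / 3).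
rewrite sx => /(_ sm pl s0 M1 M3 (lexx _)).
have hs : (3 * l%:R - n%:R) / 2 <= S + (prefix_dev rho x n m + 1) / 3.
  by apply: le_trans lT _; move: hS; clear; lra.
move=> /(_ hs); apply: le_trans.
(* The factor 2 serves the window ending at [n], where the endpoint deviation is the same as the
   subtracted one. *)
have dE : prefix_dev rho x p m + prefix_dev rho x (p + l) m <=
    2 * window_dev rho n l x m - prefix_dev rho x n m.
  have nl : (n - l + l = n)%N by clear -l2; lia.
  pose P k := prefix_dev rho x k m; have PE k : prefix_dev rho x k m = P k by [].
  have DP k : 0 <= P k := D k; clearbody P.
  rewrite /window_dev !PE; have := DP 0%N; have := DP l; have := DP (l + l)%N.
  have := DP (n - l)%N; have := DP n.
  move: pin; rewrite !inE => /or3P[] /eqP ->; rewrite ?add0n ?nl;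
    move: (P 0%N) (P l) (P (l + l)%N) (P (n - l)%N) (P n); clear => *; lra.
have nE : prefix_dev rho x n m <= window_dev rho n l x m.
  rewrite /window_dev; have := D 0%N; have := D l; have := D (l + l)%N.
  by have := D (n - l)%N; clear; lra.
have Z1 : 1 <= rho^-1 by rewrite invf_ge1.
set w := window_dev rho n l x m in dE nE *; set d := prefix_dev rho x n m in dE nE *.
have d0 : 0 <= d := D n.
set e := prefix_dev rho x p m + _ in dE *.
have : (4 * (e + d) + d / 3 + 7) / rho <= (9 * w + 7) / rho.
  by apply: ler_wpM2r; [rewrite invr_ge0 ltW|move: dE nE d0; clear; lra].
have : d <= d / rho by rewrite ler_peMr.
clear; lra.
Qed.

(** * Chebyshev penalties and the improved bound *)

Lemma changes_lipschitz (R : realType) (x : seq bool) :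
  mask_lipschitz (size x) 2 (fun m => (changes (mask m x))%:R : R).
Proof.
move=> s1 s2 e; have [x1 [c [x2 [_ [_ [_ hb]]]]]] := mask_split e.
rewrite !hb /=; set y1 := mask s1 x1; set y2 := mask s2 x2.
have h1 : (changes (y1 ++ y2) <= changes (y1 ++ c :: y2))%N.
  by apply: changes_subseq; apply: cat_subseq => //; exact: subseq_cons.
have := changes_insert y1 c y2; move: h1; rewrite -!(ler_nat R) natrD => h1 h2.
by rewrite ger0_norm ?subr_ge0 //; move: h2; clear; lra.
Qed.

(** Chebyshev's inequality before taking expectations: a loss [c] on deviations of at least [d] is
    dominated by a multiple of the squared deviation. *)
Lemma chebyshev_bound (R : realType) (a b d c : R) : 0 < d -> 0 <= c ->
  d <= `|a - b| -> c <= c / d ^+ 2 * (a - b) ^+ 2.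
Proof.
move=> d0 c0 h; rewrite mulrAC ler_pdivlMr ?exprn_gt0 //; apply: ler_wpM2l => //.
by rewrite -[(a - b) ^+ 2]real_normK ?num_real // lerXn2r ?nnegrE // ltW.
Qed.

Lemma chebyshev_expect (R : realType) (rho : R) n L (F : seq bool -> R) (c d : R) :
  0 <= rho -> rho <= 1 -> 0 <= L -> mask_lipschitz n L F -> 0 <= c ->
  mask_expect rho n (fun m => c / d ^+ 2 * (F m - mask_expect rho n F) ^+ 2) <=
  c / d ^+ 2 * (n%:R * rho * L ^+ 2).
Proof.
move=> r0 r1 L0 hF c0; rewrite mask_expectZ; apply: ler_wpM2l.
  by rewrite divr_ge0 // sqr_ge0.
exact: mask_variance.
Qed.

(** The best window is used if the trace has at least [T] changes, otherwise the trace is stretched.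
    The window bound holds whenever that branch is taken, so only stretching can mislead. It is
    improbable if the expected number of changes is at least [2 * T]; otherwise it beats the target
    [G] unless the score deviates. *)
Lemma L1worst_ge_improved (R : realType) (rho t : R) n : 0 < rho -> rho <= 1 ->
  0 < t -> t <= (1 / 100) ^+ 4 -> 9 / 2 <= t * (rho * n%:R) ->
  102 * 100 + 2 * Num.sqrt (rho * n%:R) <= 75 / (100 * 100) * (rho * n%:R) ->
  2 / 3 * n%:R + t * rho * n%:R / 9 -
    (135 * Num.sqrt (rho * n%:R) + 8 + (4 / t ^+ 2 + 64 * 100 * 100)) / rho
    <= L1worst (1 - rho) n.
Proof.
move=> rho0 rho1 t0 t1 hT hs; have r0 := ltW rho0.
have Z1 : 1 <= rho^-1 by rewrite invf_ge1.
set T := t * (rho * n%:R) in hT.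
have N0 : 0 <= n%:R :> R := ler0n _ _.
have Tn : T <= n%:R * (1 / 100) ^+ 4.
  have h : rho * n%:R <= n%:R by rewrite ler_piMl.
  apply: (@le_trans _ _ (t * n%:R)); first by apply: ler_wpM2l => //; exact: ltW.
  by rewrite mulrC; apply: ler_wpM2l.
have npos : (0 < n)%N.
  rewrite lt0n; apply/eqP => e0; move: hT; rewrite /T e0 !mulr0; clear; lra.
have n0 : 0 < n%:R :> R by rewrite ltr0n.
(* Up to rounding, [(n + l) / 2] becomes [2 n / 3 + T / 9], and the window needs [T / 3] changes,
   which is what the best of three windows offers. *)
pose l := Num.truncn (n%:R / 3 + 2 / 9 * T).
have /truncn_itv/andP[] : 0 <= n%:R / 3 + 2 / 9 * T.
  by move: N0 hT; clear; lra.
rewrite -/l -[l.+1]addn1 natrD => lu ll.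
have l2 : (2 * l <= n)%N.
  by rewrite -(ler_nat R) natrM; move: lu Tn N0; clear; lra.
have l3 : (n <= 3 * l)%N.
  by rewrite -(ler_nat R) natrM; move: ll hT; clear; lra.
have lT : (3 * l%:R - n%:R) / 2 <= T / 3 by move: lu; clear; lra.
have [w [q [kappa [k0 k1 kw w2 [qn wq kq]]]]] := stretch_parameters n rho0 rho1.
pose W := (Num.truncn (100 * 100 / rho)).+1.
have /truncn_itv/andP[] : 0 <= 100 * 100 / rho :> R.
  by rewrite divr_ge0 ?mulr_ge0 ?ler0n.
rewrite -/W ler_pdivlMr // ltr_pdivrMr // => W1 W0.
have {}W0 : 100 * 100 <= rho * W%:R by rewrite [rho * _]mulrC; exact: ltW.
have {}W1 : rho * W%:R <= 101 * 100.
  by rewrite /W -[(_ _).+1]addn1 natrD mulrC mulrDl; move: W1 rho1; clear; lra.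
have /choice[D hD] (y : seq bool) : exists z : n.-tuple bool,
    (T <= (changes y)%:R -> good_window rho n l y z) /\
    ((changes y)%:R < T -> z = padded_stretch n w y :> seq bool).
  have [h|h] := lerP T (changes y)%:R.
    have [z hz] := good_window_exists y r0 l2 l3.
    by exists (Tuple (introT eqP (size_good_window l2 hz))); split => // h'.
  by exists (Tuple (introT eqP (size_padded_stretch n w y))); split.
apply: (@L1worst_ge R rho n D) => x.
have sx : size x = n := size_tuple x.
pose G : R := 2 / 3 * n%:R + T / 9.
pose X m : R := (lcs (D (mask m x)) x)%:R.
(* [V] is a Chebyshev penalty for the masks on which the choice made from the
   trace is misleading. *)
have key (V : seq bool -> R) : (forall m, 0 <= V m) ->
    (forall m, size m = n -> (changes (mask m x))%:R < T -> G - V m <= X m) ->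
    mask_expect rho n V <= (4 / t ^+ 2 + 64 * 100 * 100) / rho ->
    2 / 3 * n%:R + t * rho * n%:R / 9 -
    (135 * Num.sqrt (rho * n%:R) + 8 + (4 / t ^+ 2 + 64 * 100 * 100)) / rho <=
    mask_expect rho n X.
  move=> V0 hV EV.
  apply: (@le_trans _ _ (mask_expect rho n (fun m => (G - 8 / rho) +
     (- (9 / rho) * window_dev rho n l x m + -1 * V m)))).
    rewrite mask_expectD mask_expect_cst mask_expectD mask_expectZ mask_expectZ.
    have := window_dev_expect rho0 rho1 l2 sx.
    set dv := mask_expect rho n (window_dev rho n l x); set s := Num.sqrt _ => hdv.
    have {}hdv : 9 / rho * dv <= 9 / rho * (15 * s) by apply: ler_wpM2l => //; rewrite divr_ge0.
    have -> : (135 * s + 8 + (4 / t ^+ 2 + 64 * 100 * 100)) / rho =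
      9 / rho * (15 * s) + 8 / rho + (4 / t ^+ 2 + 64 * 100 * 100) / rho by ring.
    have -> : t * rho * n%:R = T by rewrite /T mulrA.
    rewrite /G mulNr; move: EV hdv; set b := (4 / t ^+ 2 + _) / rho.
    move: (mask_expect rho n V) (9 / rho * dv) (9 / rho * (15 * s)) (8 / rho) b => v1 v2 v3 v4 v5.
    by clear; lra.
  apply: mask_expect_le => // m sm.
  have wd0 : 0 <= window_dev rho n l x m by exact: window_dev_ge0.
  have wd1 : 0 <= 9 / rho * window_dev rho n l x m by rewrite mulr_ge0 ?divr_ge0.
  have [Ty|yT] := lerP T (changes (mask m x))%:R.
    have := good_window_lcs rho0 rho1 l2 lT sx sm ((hD _).1 Ty) Ty.
    rewrite -/(X m); apply: le_trans.
    have -> : (9 * window_dev rho n l x m + 7) / rho = 9 / rho * window_dev rho n l x m + 7 / rho.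
      by ring.
    rewrite !mulNr /G; move: (V0 m) ll Z1; move: (9 / rho * _) (V m) => v1 v2.
    by clear; lra.
  apply: le_trans (hV m sm yT); rewrite !mulNr; move: wd1 Z1; move: (9 / rho * _) (V m) => v1 v2.
  by clear; lra.
pose ch m : R := (changes (mask m x))%:R.
have X0 m : 0 <= X m := ler0n _ _.
have Gn : G <= 675 / 1000 * n%:R.
  by rewrite /G; move: Tn N0; clear; lra.
have T0 : 0 < T by move: hT; clear; lra.
have tZ : 0 <= 4 / t ^+ 2 by rewrite divr_ge0 // sqr_ge0.
(* In the first case a trace with fewer than [T] changes is at least [T] below the mean, and the
   penalty there is at least [n], hence at least [G]. *)
have [rich|poor] := lerP (2 * T) (mask_expect rho n ch).
  apply: (key (fun m => n%:R / T ^+ 2 * (ch m - mask_expect rho n ch) ^+ 2)).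
  - by move=> m; rewrite mulr_ge0 ?sqr_ge0 // divr_ge0 ?ler0n ?sqr_ge0.
  - move=> m sm yT.
    have : T <= `|ch m - mask_expect rho n ch|.
      rewrite ler0_norm; last by move: yT rich T0; rewrite -/(ch m); clear; lra.
      by move: yT rich; rewrite -/(ch m); clear; lra.
    move=> /(chebyshev_bound T0 N0); move: (X0 m) Gn N0; clear; lra.
  have hl : mask_lipschitz n 2 ch by rewrite -{1}sx; exact: changes_lipschitz.
  apply: le_trans (chebyshev_expect T r0 rho1 (ler0n _ 2) hl N0) _.
  have -> : n%:R / T ^+ 2 * (n%:R * rho * 2 ^+ 2) = 4 / t ^+ 2 / rho.
    by rewrite /T; field; rewrite !gt_eqF.
  by apply: ler_wpM2r; rewrite ?invr_ge0 // lerDl !mulr_ge0 ?ler0n.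
(* The mean score is at least 0.68 n while [G] is at most 0.675 n, so stretching misses [G] only if
   the score is at least [n / 200] away from its mean. *)
set F := stretch_score rho w (take q x); have EH : 68 / 100 * n%:R <= mask_expect rho q F.
  have := @stretch_score_expect R rho w W q kappa (2 * T) x.
  rewrite sx => /(_ rho0 rho1 k0 k1 kw w2 W0 W1 qn kq (ltW poor)).
  apply: le_trans.
  set s := Num.sqrt _ in hs *.
  have : (102 * 100 + 2 * s) / rho <= 75 / (100 * 100) * n%:R.
    by rewrite ler_pdivrMr // -[leRHS]mulrA [n%:R * rho]mulrC.
  have -> : (101 * 100 + 204 * 100 * (2 * T) + 2 * s) / rho =
     (102 * 100 + 2 * s) / rho - 100 / rho + 408 * 100 * (t * n%:R).
    by rewrite /T; field; rewrite gt_eqF.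
  have tn : t * n%:R <= (1 / 100) ^+ 4 * n%:R by apply: ler_wpM2r.
  have n9 : 1 <= n%:R :> R by rewrite ler1n.
  move: tn n9 Z1; move: (t * n%:R) ((_ + 2 * s) / rho) => v1 v2; clear; lra.
have d0 : 0 < n%:R / 200 :> R by rewrite divr_gt0.
pose V m : R := n%:R / (n%:R / 200) ^+ 2 * (F m - mask_expect rho q F) ^+ 2.
have V0 m : 0 <= V m by rewrite mulr_ge0 ?sqr_ge0 // divr_ge0 ?ler0n ?sqr_ge0.
apply: (key (fun m => V (take q m))) => // [m sm yT|].
  have hF : F (take q m) <= X m.
    have := @stretch_score_le R rho w q x m; rewrite sx => /(_ sm qn wq).
    by rewrite /X ((hD _).2 yT).
  have [far|near] := lerP (n%:R / 200) `|F (take q m) - mask_expect rho q F|.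
    have := chebyshev_bound d0 N0 far; rewrite -/(V _); move: (X0 m) Gn N0.
    by move: (V _) => v; clear; lra.
  move: near; rewrite ltr_norml => /andP[near _].
  by move: (V0 (take q m)) hF near EH Gn; move: (V _) => v; clear; lra.
rewrite (mask_expect_take r0 rho1 V qn).
have hl : mask_lipschitz q (2 * w%:R) F.
  have -> : q = size (take q x) by rewrite size_takel // sx.
  exact: stretch_score_lipschitz.
have L0 : 0 <= 2 * w%:R :> R by rewrite mulr_ge0.
apply: le_trans (chebyshev_expect (n%:R / 200) r0 rho1 L0 hl N0) _.
have -> : n%:R / (n%:R / 200) ^+ 2 * (q%:R * rho * (2 * w%:R) ^+ 2) =
    16 * 100 * 100 * (q%:R / n%:R) * (w%:R * rho) ^+ 2 / rho.
  by field; rewrite !gt_eqF.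
apply: ler_wpM2r; first by rewrite invr_ge0.
have qn1 : q%:R / n%:R <= 1 :> R by rewrite ler_pdivrMr // mul1r ler_nat.
have w4 : (w%:R * rho) ^+ 2 <= 2 ^+ 2 by rewrite lerXn2r ?nnegrE ?mulr_ge0.
have qw : q%:R / n%:R * (w%:R * rho) ^+ 2 <= 1 * 2 ^+ 2.
  by apply: ler_pM => //; rewrite ?divr_ge0 ?sqr_ge0.
rewrite -[X in X <= _]mulrA; move: qw tZ; set v1 := q%:R / n%:R * _; set v2 := 4 / _.
by move: v1 v2 => v1 v2; clear; lra.
Qed.

(** The gain has order [rho * n] and the main error has the order of the root of [rho * n], divided
    by [rho]. The gain dominates once [rho ^+ 3 * n] exceeds a large constant. *)
Lemma L1worst_ge_linear_gain (R : realType) : exists c K : R, [/\ 0 < c, 1 <= K &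
  forall (n : nat) (rho : R), 0 < rho -> rho <= 1 -> K ^+ 2 <= rho ^+ 3 * n%:R ->
    (2 / 3 + c * rho) * n%:R <= L1worst (1 - rho) n].
Proof.
have [t [t0 t1 th]] : exists t : R, [/\ 0 < t, t <= (1 / 100) ^+ 4 & t <= 1 / 100].
  have a0 : 0 < 1 / 100 :> R by lra.
  have a1 : 1 / 100 <= 1 :> R by lra.
  move: (1 / 100) a0 a1 => a a0 a1; exists (a ^+ 4); split; rewrite ?exprn_gt0 //.
  by rewrite exprS ler_piMr ?exprn_ile1 // ltW.
pose C : R := 8 + (4 / t ^+ 2 + 64 * 100 * 100).
have C0 : 0 <= C.
  have : 0 <= 4 / t ^+ 2 by rewrite divr_ge0 ?ler0n ?sqr_ge0.
  by rewrite /C; move: (4 / _) => v; clear; lra.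
(* Chosen so that [135 * s] and [C] are each at most [t * u / 36]; divided by [rho], they consume
   together half of the gain [t * r / 9]. *)
pose K := (135 * 36 + 36 * C) / t.
have Kt : K * t = 135 * 36 + 36 * C by rewrite divfK ?gt_eqF.
have K1 : 100 * 100 <= K.
  rewrite ler_pdivlMr //; move: th C0; clear; lra.
have K0 : 0 < K by move: K1; clear; lra.
exists (t / 18), K; split; [by rewrite divr_gt0|move: K1; clear; lra|].
move=> n rho r0 r1 hK.
set s := Num.sqrt (rho * n%:R); set r := rho * n%:R in s.
have r_ge0 : 0 <= r by rewrite mulr_ge0 // ltW.
have sr : s ^+ 2 = r by rewrite sqr_sqrtr.
have s_ge0 : 0 <= s := sqrtr_ge0 _.
pose u := rho * r.
have u_ge0 : 0 <= u by rewrite mulr_ge0 // ltW.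
have u3 : rho ^+ 3 * n%:R = rho * u by rewrite /u /r; ring.
have Ku : K ^+ 2 <= u by apply: le_trans hK _; rewrite u3 ler_piMl.
have ur : u <= r by rewrite ler_piMl.
have Ks : K <= s by rewrite -(@ler_sqr R) ?nnegrE ?sr ?(ltW K0) // (le_trans Ku).
have Ksu : K * s <= u.
  have Ks0 : 0 <= K * s by rewrite mulr_ge0 // ltW.
  rewrite -(@ler_sqr R) ?nnegrE // exprMn sr.
  have -> : u ^+ 2 = rho ^+ 3 * n%:R * r by rewrite u3 /u; ring.
  exact: ler_wpM2r.
have hb : 102 * 100 + 2 * s <= 75 / (100 * 100) * r.
  have : 100 * 100 * s <= s ^+ 2.
    by rewrite expr2; apply: ler_wpM2r => //; exact: le_trans Ks.
  rewrite sr; move: K1 Ks; clear; lra.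
have ha : 9 / 2 <= t * r.
  have : K * t <= t * r by rewrite mulrC; apply: ler_wpM2l; [exact: ltW|rewrite -sr; nra].
  by rewrite Kt; move: C0; clear; lra.
apply: le_trans (L1worst_ge_improved r0 r1 t0 t1 ha hb); rewrite -/r -/s.
have hs : 135 * s <= t * u / 36.
  have : s * (K * t) <= t * u by rewrite mulrA mulrC; apply: ler_wpM2l; [exact: ltW|rewrite mulrC].
  rewrite Kt; have := mulr_ge0 s_ge0 C0; clear; lra.
have hC : C <= t * u / 36.
  have : t * K <= t * u.
    apply: ler_wpM2l; first exact: ltW.
    by apply: le_trans Ku; rewrite expr2 ler_peMr ?ltW //; move: K1; clear; lra.
  by rewrite mulrC Kt; clear; lra.
have : (135 * s + C) / rho <= t / 18 * r.
  rewrite ler_pdivrMr // -[leRHS]mulrA [r * rho]mulrC -/u; move: hs hC; clear; lra.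
have -> : t * rho * n%:R / 9 = 2 * (t / 18 * r) by rewrite /r; field.
have -> : (2 / 3 + t / 18 * rho) * n%:R = 2 / 3 * n%:R + t / 18 * r by rewrite /r; ring.
have -> : 135 * s + 8 + (4 / t ^+ 2 + 64 * 100 * 100) = 135 * s + C by rewrite /C [RHS]addrA.
clear; lra.
Qed.

(** * Passage to the limit *)

Local Open Scope classical_set_scope.
Local Open Scope ring_scope.

Theorem theorem1p1 (R : realType) :
  (forall rho : nat -> R,
     (forall n : nat, (0 < n)%N -> 0 < rho n <= 1) ->
     (rho n * n%:R / ln (n%:R : R)) @[n --> \oo] --> +oo ->
     exists e : nat -> R,
       e n @[n --> \oo] --> (0 : R) /\
       forall n : nat, (0 < n)%N ->
         (2 / 3 - e n) * n%:R <= L1worst (1 - rho n) n) /\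
  (exists c : R, 0 < c /\
     forall rho : nat -> R,
       (forall n : nat, (0 < n)%N -> 0 < rho n <= 1) ->
       (rho n * (n%:R : R) `^ (1 / 3)) @[n --> \oo] --> +oo ->
       \forall n \near \oo,
         (2 / 3 + c * rho n) * n%:R <= L1worst (1 - rho n) n).
Proof.
split.
  move=> rho hrho hlim.
  exists (fun n => (36 * Num.sqrt (rho n * n%:R) + 8) / (rho n * n%:R)); split; last first.
    move=> n n0; have /andP[r0 r1] := hrho n n0.
    apply: le_trans (L1worst_ge_two_thirds r0 r1 n0).
    have n0' : n%:R != 0 :> R by rewrite pnatr_eq0 -lt0n.
    rewrite mulrBl lerD2l lerN2 le_eqVlt; apply/orP; left; apply/eqP.
    by field; rewrite n0' gt_eqF.
  apply/cvgrPdist_le => eps eps0.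
  (* Once [r = rho n * n] is at least [M], its root [s] is at least 1 and at least [44 / eps],
     whence [36 * s + 8 <= 44 * s <= eps * s ^+ 2]. *)
  pose M : R := (44 / eps) ^+ 2 + 1.
  near=> n.
  have n0 : (0 < n)%N by near: n; exact: nbhs_infty_gt.
  have /andP[r0 r1] := hrho n n0.
  have hn : expR 1 <= n%:R :> R by near: n; exact: nbhs_infty_ger.
  have hM : M <= rho n * n%:R / ln n%:R by near: n; move/cvgryPge : hlim; exact.
  have ln1 : 1 <= ln (n%:R : R).
    by rewrite -[X in X <= _](expRK 1) ler_ln // posrE ?expR_gt0 // ltr0n.
  (* The logarithm is at least 1 here, so the bound on the quotient passes to its numerator. *)
  have {}hM : M <= rho n * n%:R.
    apply: le_trans hM _; rewrite ler_pdivrMr ?(lt_le_trans ltr01) //.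
    by rewrite ler_peMr // mulr_ge0 // ltW.
  set r := rho n * n%:R in hM *; set s := Num.sqrt r.
  have sq : 0 <= (44 / eps) ^+ 2 by exact: sqr_ge0.
  have rp : 0 < r by move: hM sq; rewrite /M; clear; lra.
  have sr : s ^+ 2 = r by rewrite sqr_sqrtr // ltW.
  have s1 : 1 <= s by rewrite -sqrtr1 ler_wsqrtr //; move: hM sq; rewrite /M; clear; lra.
  have s2 : 44 / eps <= s.
    rewrite -(@ler_sqr R) ?nnegrE ?sqrtr_ge0 ?divr_ge0 // ?(ltW eps0) // sr.
    by move: hM; rewrite /M; clear; lra.
  have s0 : 0 <= s := sqrtr_ge0 _.
  rewrite sub0r normrN ger0_norm; last first.
    by rewrite divr_ge0 ?(ltW rp) // addr_ge0 // mulr_ge0.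
  rewrite ler_pdivrMr // -sr expr2 mulrA.
  apply: (@le_trans _ _ (44 * s)); first by move: s1; clear; lra.
  by apply: ler_wpM2r => //; rewrite mulrC -ler_pdivrMr.
have [c [K [c0 K1 hK]]] := L1worst_ge_linear_gain R.
exists c; split => // rho hrho hlim.
near=> n.
have n0 : (0 < n)%N by near: n; exact: nbhs_infty_gt.
have /andP[r0 r1] := hrho n n0.
have hM : K ^+ 2 <= rho n * n%:R `^ (1 / 3) by near: n; move/cvgryPge : hlim; exact.
apply: hK => //.
have KK : 1 <= K ^+ 2 by exact: exprn_ege1.
(* Cubing turns the cube root of [n] into [n], and a quantity that is at least [K ^+ 2 >= 1] is at
   most its own cube. *)
have -> : rho n ^+ 3 * n%:R = (rho n * n%:R `^ (1 / 3)) ^+ 3.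
  rewrite exprMn; congr (_ * _); rewrite -powR_mulrn ?powR_ge0 // -powRrM.
  by rewrite divfK ?powRr1.
apply: (le_trans hM); rewrite -[leLHS]expr1 ler_weXn2l //.
exact: le_trans KK hM.
Unshelve. all: by end_near.
Qed.
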